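(* Let $n\ge 4$ and let $\Gamma_p^-(n,n)$ be the set of all unbalanced bipartite unicyclic signed graphs on $n$ vertices. If $\Gamma\in\Gamma_p^-(n,n)$, then $EE(\Gamma)\le EE(\Gamma_n^{4-})$, with equality if and only if $\Gamma$ is switching equivalent to $\Gamma_n^{4-}$.
   Context: Graphs are finite and simple. A signed graph $\Gamma=(G,\sigma)$ is a graph $G$ together with a function $\sigma:E(G)\to\{-1,1\}$. Its adjacency matrix $A_\Gamma$ is the symmetric matrix with $(i,j)$ entry $\sigma(ij)$ if $ij\in E(G)$ and $0$ otherwise; the eigenvalues $\mu_1,\dots,\mu_n$ of $\Gamma$ are those of $A_\Gamma$, counted with multiplicity. The Estrada index is $EE(\Gamma)=\sum_{i=1}^n e^{\mu_i}$. The sign of a cycle is the product of the signs of its edges; a signed graph is balanced if all its cycles are positive, and unbalanced otherwise. A signed graph is bipartite if its underlying graph is bipartite. A (signed) graph is unicyclic if it is connected and has the same number of vertices and edges. For $Z\subseteq V(\Gamma)$, switching with respect to $Z$ reverses the signs of all edges with exactly one endpoint in $Z$. Two signed graphs are called switching equivalent if one can be obtained from the other by switching, where signed graphs are considered up to isomorphism (relabelling of vertices). $\Gamma_n^{4-}$ denotes the signed graph on $n$ vertices obtained by identifying the center of the star $S_{n-3}$ (on $n-3$ vertices) with a vertex of a negative 4-cycle; that is, a negative 4-cycle with $n-4$ pendant edges attached at one of its vertices (the signs of the pendant edges are irrelevant up to switching). *)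

(* Defs.v *)
From HB Require Import structures.
From mathcomp Require Import all_boot all_order all_algebra perm.
From mathcomp Require Import spectral complex.
From mathcomp Require Import all_classical all_reals.
From mathcomp Require Import sequences.

Set Implicit Arguments.
Unset Strict Implicit.
Unset Printing Implicit Defensive.

Import Order.TTheory GRing.Theory Num.Theory.

Local Open Scope ring_scope.

Record sgraph (n : nat) := SGraph {
  adj :> rel 'I_n;
  adj_sym : symmetric adj;
  adj_irrefl : irreflexive adj
}.

(* Only the values of [sigma] on adjacent pairs are meaningful. *)
Record signed_graph (n : nat) := SignedGraph {
  ugraph : sgraph n;
  sigma : 'I_n -> 'I_n -> int;
  sigma_sym : forall u v, sigma u v = sigma v u;
  sigma_sign : forall u v, ugraph u v -> sigma u v = 1 \/ sigma u v = - 1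
}.

Section Spectrum.
Variable R : realType.

Definition is_spectrum n (A : 'M[R]_n) (s : seq R) : Prop :=
  char_poly A = \prod_(x <- s) ('X - x%:P).

(* The eigenvalues with algebraic multiplicity, in some order; the default
   value is never reached for real symmetric A, see [spectrumP]. *)
Definition spectrum n (A : 'M[R]_n) : seq R :=
  xget [::] [set s : seq R | is_spectrum A s].

Lemma symmetric_has_spectrum n (A : 'M[R]_n) :
  A^T = A -> exists s, is_spectrum A s.
Proof.
move=> symA.
pose f := real_complex R; pose B := map_mx f A.
have hB : B \is hermsymmx.
  apply: realsym_hermsym; last first.
    by apply/mxOverP => i j; rewrite mxE; apply/complex_realP; exists (A i j).
  by apply/is_hermitianmxP; rewrite expr0 scale1r map_mx_id // map_trmx symA.
have /mxOverP dR := hermitian_spectral_diag_real hB.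
have simB := orthomx_spectralP (hermitian_normalmx hB).
have cB : char_poly B = char_poly (diag_mx (spectral_diag B)).
  set P := spectralmx B in simB *; set D := diag_mx _ in simB *.
  have uP : P \in unitmx by apply: spectral_unit.
  have eqM : map_mx polyC (invmx P) *m char_poly_mx D *m map_mx polyC P
           = char_poly_mx B.
    rewrite /char_poly_mx mulmxBr mulmxBl -!map_mxM -simB.
    by rewrite scalar_mxC -mulmxA -map_mxM mulVmx // map_mx1 mulmx1.
  rewrite /char_poly -eqM !det_mulmx mulrAC -det_mulmx -map_mxM mulVmx //.
  by rewrite map_mx1 det1 mul1r.
exists [seq complex.Re (spectral_diag B 0 i) | i <- enum 'I_n].
apply: (map_poly_inj f); rewrite map_char_poly -/B cB char_poly_trig; last first.
  exact: diag_mx_is_trig.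
rewrite big_map rmorph_prod /= big_enum /=; apply: eq_bigr => i _.
rewrite mxE eqxx mulr1n rmorphB /= map_polyX map_polyC /=.
by congr (_ - _%:P); rewrite /f RRe_real.
Qed.

Lemma spectrumP n (A : 'M[R]_n) : A^T = A -> is_spectrum A (spectrum A).
Proof.
by move=> /symmetric_has_spectrum[s As]; apply: (xgetPex [::] (ex_intro _ s As)).
Qed.

Definition adjacency n (G : signed_graph n) : 'M[R]_n :=
  \matrix_(i, j) if ugraph G i j then (sigma G i j)%:~R else 0.

Lemma tr_adjacency n (G : signed_graph n) : (adjacency G)^T = adjacency G.
Proof. by apply/matrixP => i j; rewrite !mxE adj_sym sigma_sym. Qed.

Definition EE n (G : signed_graph n) : R :=
  \sum_(mu <- spectrum (adjacency G)) expR mu.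

End Spectrum.

(* Cycles are duplicate-free closed walks on at least three vertices; the edges
   of the cycle c are the pairs formed by x and its cyclic successor. *)
Definition cycle_of n (G : sgraph n) (c : seq 'I_n) : Prop :=
  (3 <= size c)%N /\ ucycle G c.

Definition cycle_sign n (G : signed_graph n) (c : seq 'I_n) : int :=
  \prod_(x <- c) sigma G x (next c x).

Definition balanced n (G : signed_graph n) : Prop :=
  forall c : seq 'I_n, cycle_of (ugraph G) c -> cycle_sign G c = 1.

Definition bipartite n (G : sgraph n) : Prop :=
  exists X : {set 'I_n}, forall u v, G u v -> (u \in X) != (v \in X).

Definition edges n (G : sgraph n) : {set {set 'I_n}} :=
  [set [set p.1; p.2] | p : 'I_n * 'I_n & G p.1 p.2].

Definition connected n (G : sgraph n) : Prop :=
  (0 < n)%N /\ forall u v : 'I_n, connect G u v.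

Definition unicyclic n (G : sgraph n) : Prop :=
  connected G /\ #|edges G| = n.

Definition unbalanced_bipartite_unicyclic n (G : signed_graph n) : Prop :=
  [/\ ~ balanced G, bipartite (ugraph G) & unicyclic (ugraph G)].

Section Switching.
Variables (n : nat) (Z : {set 'I_n}) (G : signed_graph n).

Definition switch_sigma (u v : 'I_n) : int :=
  if (u \in Z) (+) (v \in Z) then - sigma G u v else sigma G u v.

Lemma switch_sigma_sym u v : switch_sigma u v = switch_sigma v u.
Proof. by rewrite /switch_sigma addbC sigma_sym. Qed.

Lemma switch_sigma_sign u v :
  ugraph G u v -> switch_sigma u v = 1 \/ switch_sigma u v = - 1.
Proof.
rewrite /switch_sigma => /sigma_sign[] ->; case: ifP => _; rewrite ?opprK; auto.
Qed.

Definition switch : signed_graph n :=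
  SignedGraph switch_sigma_sym switch_sigma_sign.

End Switching.

Definition isomorphic n (G H : signed_graph n) : Prop :=
  exists f : {perm 'I_n},
    (forall u v, ugraph H (f u) (f v) = ugraph G u v) /\
    (forall u v, ugraph G u v -> sigma H (f u) (f v) = sigma G u v).

Definition switching_equivalent n (G H : signed_graph n) : Prop :=
  exists Z : {set 'I_n}, isomorphic (switch Z G) H.

(* The 4-cycle is 0 - 1 - 2 - 3 - 0, its only negative edge is 1 - 2, and the
   vertices 4, ..., n - 1 are pendant at 0. This is meant for 4 <= n. *)
Definition gamma4_arc (i j : nat) : bool :=
  ((i, j) \in [:: (0, 1); (1, 2); (2, 3); (0, 3)]%N) ||
  (i == 0)%N && (4 <= j)%N.

Definition gamma4_adj n : rel 'I_n :=
  fun u v => gamma4_arc u v || gamma4_arc v u.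

Lemma gamma4_adj_sym n : symmetric (@gamma4_adj n).
Proof. by move=> u v; rewrite /gamma4_adj orbC. Qed.

Lemma gamma4_adj_irrefl n : irreflexive (@gamma4_adj n).
Proof.
by move=> u; rewrite /gamma4_adj orbb /gamma4_arc; case: u => -[|[|[|[|]]]].
Qed.

Definition gamma4_sigma n (u v : 'I_n) : int :=
  if ((val u, val v) \in [:: (1, 2); (2, 1)]%N) then - 1 else 1.

Lemma gamma4_sigma_sym n (u v : 'I_n) : gamma4_sigma u v = gamma4_sigma v u.
Proof.
by rewrite /gamma4_sigma !inE !xpair_eqE orbC [X in X || _]andbC
  [X in _ || X]andbC.
Qed.

Lemma gamma4_sigma_sign n (u v : 'I_n) :
  SGraph (@gamma4_adj_sym n) (@gamma4_adj_irrefl n) u v ->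
  gamma4_sigma u v = 1 \/ gamma4_sigma u v = - 1.
Proof. by move=> _; rewrite /gamma4_sigma; case: ifP; auto. Qed.

Definition gamma4neg n : signed_graph n :=
  SignedGraph (@gamma4_sigma_sym n) (@gamma4_sigma_sign n).

(* Main.v *)
Require Import Defs.
From mathcomp Require Import all_boot all_order all_algebra.
From mathcomp Require Import all_classical all_reals.
From mathcomp Require Import perm topology normedtype sequences.
From mathcomp Require Import ring lra zify.

(* Write mu for the eigenvalues of G. As G is bipartite, they are symmetric about
   0, so EE(G) is n plus a positive combination of the even power sums of mu, that
   is, of the power sums of the squares y = mu^2 of the positive eigenvalues. These
   y sum to n and there are at most n / 2 of them. If all of them are below n - 2
   with n > 4, they are majorized by (n - 2, 2), which are the values of y for
   the extremal graph, and the inequality is strict for the fourth moment.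

   To bound mu, let w be an eigenvector, let X be one side of the bipartition and
   put y(i, j) = w_i w_j for i in X and j outside X. The quadratic form of w is
   the sum of +-y(i, j) over the n edges, and mu^2 is at most n by Cauchy-Schwarz.
   The four edges of a negative 4-cycle form a 2 x 2 block of norm sqrt 2, so that
   they count for 2 only, whence mu^2 <= n - 2; equality forces y to vanish on
   the nonedges outside the block but not on the edges there, so that all the
   vertices outside the cycle are attached to the same vertex. In a longer negative
   cycle, some edge contributes a nonpositive amount and can be dropped, and
   the norm of a path on six of its vertices is small enough. *)

Set Implicit Arguments.
Unset Strict Implicit.
Unset Printing Implicit Defensive.

Import Order.TTheory GRing.Theory Num.Theory.
Import numFieldNormedType.Exports.

Local Open Scope ring_scope.

(** * Characteristic polynomials *)

(** Taking determinants in P (X - A) = (X - B) P leaves the common factor [\det P], which is nonzero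
    and can be cancelled in a domain. *)
Lemma char_poly_conj (F : idomainType) n (P A B : 'M[F]_n) :
  P \in unitmx -> P *m A = B *m P -> char_poly A = char_poly B.
Proof.
move=> uP PA.
have: \det (map_mx polyC P *m char_poly_mx A) =
      \det (char_poly_mx B *m map_mx polyC P).
  by rewrite /char_poly_mx mulmxBr mulmxBl -!map_mxM PA scalar_mxC.
rewrite !det_mulmx [RHS]mulrC; apply: mulfI.
by rewrite det_map_mx polyC_eq0; move: uP; rewrite unitmxE;
  apply: contraTneq => ->; rewrite unitr0.
Qed.

Lemma char_polyN (F : comNzRingType) n (A : 'M[F]_n) :
  char_poly (- A) = (-1) ^+ n * (char_poly A \Po (- 'X)).
Proof.
rewrite /char_poly -det_map_mx -detZ; congr (\det _).
apply/matrixP => i j; rewrite !mxE rmorphB rmorphMn /= comp_polyX comp_polyC.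
by rewrite mulN1r opprB mulNrn opprK polyCN opprK addrC.
Qed.

Lemma char_polyN_split (F : idomainType) n (A : 'M[F]_n) (s : seq F) :
  char_poly A = \prod_(x <- s) ('X - x%:P) ->
  char_poly (- A) = \prod_(x <- s) ('X + x%:P).
Proof.
move=> As; rewrite char_polyN As rmorph_prod /=.
have -> : n = size s.
  by apply/eq_add_S; rewrite -(size_char_poly A) As size_prod_XsubC.
have -> : (-1) ^+ size s = \prod_(x <- s) (-1) :> {poly F}.
  by rewrite big_const_seq count_predT iter_mulr_1.
rewrite -big_split /=; apply: eq_bigr => x _.
by rewrite rmorphB /= comp_polyX comp_polyC mulN1r opprB opprK addrC.
Qed.

(** Substituting X^2 for X turns X - A^2 into (X - A)(X + A), and this substitution is injective on
    polynomials. *)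
Lemma char_poly_sqr_split (F : idomainType) n (A : 'M[F]_n) (s : seq F) :
  char_poly A = \prod_(x <- s) ('X - x%:P) ->
  char_poly (A *m A) = \prod_(x <- s) ('X - (x ^+ 2)%:P).
Proof.
move=> As; apply/eqP;
  rewrite -subr_eq0 -(@comp_poly_eq0 _ _ 'X^2) ?size_polyXn //.
rewrite rmorphB subr_eq0 /=; apply/eqP.
have -> : (\prod_(x <- s) ('X - (x ^+ 2)%:P)) \Po 'X^2
    = char_poly A * char_poly (- A).
  rewrite As (char_polyN_split As) -big_split rmorph_prod /=;
    apply: eq_bigr => x _.
  by rewrite rmorphB /= comp_polyX comp_polyC rmorphXn /= -subr_sqr.
rewrite /char_poly -det_mulmx -det_map_mx; congr (\det _).
rewrite /char_poly_mx map_mxN opprK mulmxBl !mulmxDr -scalar_mxM -map_mxM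
  scalar_mxC opprD addrA addrK.
apply/matrixP=> i j; rewrite !mxE rmorphB rmorphMn /= comp_polyX comp_polyC.
by rewrite expr2.
Qed.

(** For n > 0, minus each side is the second leading coefficient of the characteristic polynomial of
    [A *m A]. *)
Lemma mxtrace_sqr_split (F : idomainType) n (A : 'M[F]_n) (s : seq F) :
  char_poly A = \prod_(x <- s) ('X - x%:P) ->
  \sum_(x <- s) x ^+ 2 = \tr (A *m A).
Proof.
move=> As; case: n A As => [|n] A As.
  have: size s = 0 by apply/eq_add_S;
    rewrite -(size_char_poly A) As size_prod_XsubC.
  by case: s {As} => // _; rewrite big_nil [RHS]big_ord0.
apply: oppr_inj; rewrite -char_poly_trace // (char_poly_sqr_split As).
rewrite -(big_map (fun x => x ^+ 2) xpredT (fun x => 'X - x%:P)).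
have -> : n.+1.-1 = (size [seq x ^+ 2 | x <- s]).-1.
  by rewrite size_map -[n.+1]/(n.+2.-1) -(size_char_poly A) As size_prod_XsubC.
rewrite coefPn_prod_XsubC ?big_map // size_map.
by rewrite -[size s]/((size s).+1.-1) -(size_prod_XsubC s id) -As
  size_char_poly.
Qed.

Lemma perm_eq_prod_XaddC (F : fieldType) (s : seq F) :
  \prod_(x <- s) ('X - x%:P) = \prod_(x <- s) ('X + x%:P) ->
  perm_eq s [seq - x | x <- s].
Proof.
move=> e; apply: prod_XsubC_eq; rewrite e big_map; apply: eq_bigr => x _.
by rewrite polyCN opprK.
Qed.

(** * Power sums and exponential sums *)

Lemma cvg_sum_exp_series (R : realType) (s : seq R) :
  ((fun N => \sum_(0 <= k < N) (\sum_(x <- s) x ^+ k) / k`!%:R) @ \oo -->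
    \sum_(x <- s) expR x)%classic.
Proof.
have -> : (fun N => \sum_(0 <= k < N) (\sum_(x <- s) x ^+ k) / k`!%:R) =
    (fun N => \sum_(x <- s) series (exp_coeff x) N).
  apply/funext => N; rewrite exchange_big /=; apply: eq_bigr => k _.
  by rewrite mulr_suml.
elim: s => [|x s IH].
  under eq_fun do rewrite big_nil.
  rewrite big_nil; exact: cvg_cst.
under eq_fun do rewrite big_cons.
rewrite big_cons; apply: cvgD => //.
exact: is_cvg_series_exp_coeff.
Qed.

(** Partial sums of the exponential series compare termwise, and beyond [k0] they differ by at least
    the fixed gap [d], so that strictness survives in the limit. *)
Lemma lt_sum_expR (R : realType) (s t : seq R) (k0 : nat) :
  (forall k, \sum_(x <- s) x ^+ k <= \sum_(x <- t) x ^+ k) ->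
  \sum_(x <- s) x ^+ k0 < \sum_(x <- t) x ^+ k0 ->
  \sum_(x <- s) expR x < \sum_(x <- t) expR x.
Proof.
move=> le_st lt_k0.
set d := (\sum_(x <- t) x ^+ k0 - \sum_(x <- s) x ^+ k0) / k0`!%:R.
have d0 : 0 < d by rewrite divr_gt0 ?subr_gt0 // ltr0n fact_gt0.
rewrite -subr_gt0; apply: (lt_le_trans d0).
pose F (r : seq R) N := \sum_(0 <= k < N) (\sum_(x <- r) x ^+ k) / k`!%:R.
have cvg_ts : (F t N - F s N @[N --> \oo] -->
    \sum_(x <- t) expR x - \sum_(x <- s) expR x)%classic.
  by apply: cvgB; apply: cvg_sum_exp_series.
rewrite -(cvg_lim _ cvg_ts) //; apply: limr_ge; first exact: cvgP cvg_ts.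
near=> N.
have ltN : (k0 < N)%N by near: N; exact: nbhs_infty_gt.
rewrite /F -sumrB (bigD1_seq k0) ?mem_index_iota ?iota_uniq //=.
rewrite -mulrBl -/d lerDl; apply: sumr_ge0 => k _.
by rewrite -mulrBl mulr_ge0 ?subr_ge0 // invr_ge0 ler0n.
Unshelve. all: by end_near.
Qed.

(** The k-th power is superadditive on nonnegative numbers. *)
Lemma sumr_exp_le_exp_sum (R : realDomainType) (s : seq R) k :
  (0 < k)%N -> (forall y, y \in s -> 0 <= y) ->
  \sum_(y <- s) y ^+ k <= (\sum_(y <- s) y) ^+ k.
Proof.
case: k => // k _; elim: s => [|y s IH] s0; first by rewrite !big_nil expr0n.
have y0 : 0 <= y by apply: s0; rewrite mem_head.
have s0' z : z \in s -> 0 <= z by move=> zs; apply: s0; rewrite inE zs orbT.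
have S0 : 0 <= \sum_(z <- s) z by rewrite big_seq; apply: sumr_ge0.
rewrite !big_cons; apply: (le_trans (lerD (lexx _) (IH s0'))).
rewrite [leRHS]exprS mulrDl !exprS lerD // ler_wpM2l // lerXn2r ?nnegrE
  ?addr_ge0 //.
  by rewrite lerDl.
by rewrite lerDr.
Qed.

(** This is convexity in algebraic form: c^k - a^k and b^k - d^k share the factor c - a = b - d, and
    their cofactors compare term by term. *)
Lemma expr_convex_two (R : realDomainType) (a b c d : R) k :
  0 <= d -> d <= a -> 0 <= b -> b <= c -> a <= c -> a + b = c + d ->
  a ^+ k + b ^+ k <= c ^+ k + d ^+ k.
Proof.
move=> d0 da b0 bc ac e.
have e' : c - a = b - d by rewrite -(subrK b a) ; lra.
rewrite -subr_ge0.
have -> : c ^+ k + d ^+ k - (a ^+ k + b ^+ k) = (c ^+ k - a ^+ k) - (b ^+ k - d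
  ^+ k) by ring.
rewrite !subrXX e' -mulrBr mulr_ge0 //; first lra.
rewrite -sumrB sumr_ge0 // => i _; rewrite subr_ge0.
by apply: ler_pM; rewrite ?exprn_ge0 // lerXn2r ?nnegrE //; lra.
Qed.

(* There are at most [m / 2] terms, so the largest is at least 2, and [s] is
   majorized by [(m - 2, 2)]. *)
Lemma sumr_exp_le_majorized (R : realDomainType) (m : R) (s : seq R) :
  4 < m -> (forall y, y \in s -> 0 <= y < m - 2) ->
  \sum_(y <- s) y = m -> (size s).*2%:R <= m ->
  (forall k, (0 < k)%N -> \sum_(y <- s) y ^+ k <= (m - 2) ^+ k + 2 ^+ k) /\
  \sum_(y <- s) y ^+ 2 < (m - 2) ^+ 2 + 2 ^+ 2.
Proof.
move=> m4 sb sm size_s.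
have /hasP[y0 y0s _] : has predT s.
  by case: (s) sm => //; rewrite big_nil => m0; exfalso; lra.
have [y ys ymax] : exists2 y, y \in s & forall z, z \in s -> z <= y.
  pose y := \big[Order.max/y0]_(z <- s) z.
  exists y; last by move=> z zs; apply: le_bigmax_seq.
  rewrite /y big_seq; elim/big_ind: _ => // a b; rewrite maxEle;
    case: ifP => //.
have y2 : 2 <= y.
  have : m <= y *+ size s.
    rewrite -sm -iter_addr_0 -count_predT -big_const_seq big_seq [leRHS]big_seq.
    exact: ler_sum.
  move: size_s; rewrite -muln2 natrM -mulr_natr;
    set N : R := (size s)%:R => h1 h2.
  have N0 : 0 <= N by rewrite ler0n.
  rewrite leNgt; apply/negP => y2.
  have h3 : y * N <= 2 * N by rewrite ler_wpM2r // ltW.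
  have : 0 < (2 - y) * N by apply: mulr_gt0; lra.
  lra.
have /andP[_ ym] := sb _ ys.
have ps := perm_to_rem ys.
have srem : \sum_(z <- rem y s) z = m - y.
  by rewrite -sm (perm_big _ ps) big_cons /= addrC addrK.
have rem0 z : z \in rem y s -> 0 <= z by move=> /mem_rem /sb /andP[].
(* All terms other than the largest are merged into the single term m - y. *)
have main k : (0 < k)%N -> \sum_(z <- s) z ^+ k <= y ^+ k + (m - y) ^+ k.
  by move=> k0; rewrite (perm_big _ ps) big_cons /= lerD2l -srem
    sumr_exp_le_exp_sum.
split=> [k k0|].
  apply: le_trans (main k k0) _; apply: expr_convex_two; lra.
(* If 2 < y < m - 2, strict convexity applies. If y = 2, all terms are at most 2, so the squares sum
   to at most 2 m, and (m - 2)(m - 4) > 0. *)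
have [y2'|y2'] := ltP 2 y.
  apply: le_lt_trans (main 2 isT) _; nra.
have {y2 y2'} y2 : y = 2 by apply/eqP; rewrite eq_le y2' y2.
have : \sum_(z <- s) z ^+ 2 <= 2 * m.
  rewrite -sm mulr_sumr big_seq [leRHS]big_seq ler_sum // => z zs.
  by have := ymax z zs; have /andP[] := sb z zs; rewrite y2; nra.
nra.
Qed.

(** * The quadratic form of a bipartite graph *)

(* Writing [g = S / (c + m)], the defect [Y - S^2 / (c + m)] is the sum of
   the squares of [y - g M] off [K], of [Y_K - S_K^2 / c], and of
   [(S_K - c g)^2 / c]. *)
Lemma block_cauchy_schwarz (R : realFieldType) (I : finType) (M y : I -> R)
    (K : pred I) (c : R) :
  (forall i, M i != 0 -> M i ^+ 2 = 1) -> 0 < c ->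
  (\sum_(i | K i) M i * y i) ^+ 2 <= c * \sum_(i | K i) y i ^+ 2 ->
  let q := c + #|[set i | ~~ K i & M i != 0]|%:R in
  let S := \sum_i M i * y i in
  S ^+ 2 <= q * \sum_i y i ^+ 2 /\
  (S ^+ 2 = q * \sum_i y i ^+ 2 ->
     (forall i, ~~ K i -> y i = M i * (S / q)) /\
     \sum_(i | K i) M i * y i = c * (S / q)).
Proof.
move=> M1 c0; set SK := \sum_(i | K i) M i * y i.
set YK := \sum_(i | K i) y i ^+ 2 => leK q S.
set Y := \sum_i y i ^+ 2.
have q0 : 0 < q by rewrite ltr_wpDr.
pose g := S / q.
have eN : \sum_(i | ~~ K i) (y i - M i * g) ^+ 2 =
    (Y - YK) - g * (S - SK) *+ 2 + g ^+ 2 * (q - c).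
  have -> : Y - YK = \sum_(i | ~~ K i) y i ^+ 2.
    by rewrite /Y (bigID K) /= -/YK addrC addrK.
  have -> : S - SK = \sum_(i | ~~ K i) M i * y i.
    by rewrite /S (bigID K) /= -/SK addrC addrK.
  have -> : q - c = \sum_(i | ~~ K i) M i ^+ 2.
    rewrite /q addrC addKr -sum1_card natr_sum big_mkcond [RHS]big_mkcond /=.
    apply: eq_bigr => i _; rewrite inE.
    by case: (K i) => //=; case: eqP => [->|/eqP /M1 ->] //; rewrite expr0n.
  rewrite !mulr_sumr -sumrMnl -sumrB -big_split /=; apply: eq_bigr => i _.
  by ring.
have N0 : 0 <= \sum_(i | ~~ K i) (y i - M i * g) ^+ 2.
  by apply: sumr_ge0 => i _; apply: sqr_ge0.
have Sq : S = g * q by rewrite /g divfK ?gt_eqF.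
have eY : c * (q * Y - S ^+ 2) =
    q * (c * (\sum_(i | ~~ K i) (y i - M i * g) ^+ 2) + (c * YK - SK ^+ 2) +
         (SK - c * g) ^+ 2).
  by rewrite eN Sq; ring.
have cN0 : 0 <= c * \sum_(i | ~~ K i) (y i - M i * g) ^+ 2.
  by rewrite mulr_ge0 // ltW.
have g0 := sqr_ge0 (SK - c * g).
have leK0 : 0 <= c * YK - SK ^+ 2 by rewrite subr_ge0.
split.
  rewrite -subr_ge0 -(pmulr_rge0 _ c0) eY.
  by apply: mulr_ge0; rewrite ?(ltW q0) //; do 2!apply: addr_ge0 => //.
(* In the equality case the three nonnegative summands of [eY] all vanish. *)
move=> eS; move: eY; rewrite eS subrr mulr0 => /esym/eqP.
rewrite mulf_eq0 gt_eqF //= => /eqP e0.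
have {}cN0 : c * \sum_(i | ~~ K i) (y i - M i * g) ^+ 2 = 0 by lra.
have {}g0 : (SK - c * g) ^+ 2 = 0 by lra.
split=> [i Ki|]; apply/eqP; rewrite -subr_eq0 -sqrf_eq0; last by rewrite g0.
move/eqP: cN0; rewrite mulf_eq0 gt_eqF //= psumr_eq0; last by move=> *;
  apply: sqr_ge0.
by move/allP/(_ i); rewrite mem_index_enum Ki => /(_ isT).
Qed.

Section BipartiteEigenvector.
Variables (R : realFieldType) (n : nat) (A : 'M[R]_n) (X : {set 'I_n}).
Hypothesis symA : A^T = A.
Hypothesis bipA : forall i j, A i j != 0 -> (i \in X) != (j \in X).

(** Under [bipA] the nonzero entries have their second index outside [X], so that each edge is
    listed once, and counting these entries counts the edges. *)
Definition biadj (p : 'I_n * 'I_n) : R := if p.1 \in X then A p.1 p.2 else 0.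

(** This is the outer product of the two halves of [w], viewed as a vector indexed by pairs; its
    squared norm is the product of those of the halves. *)
Definition crossprod (w : 'rV[R]_n) (p : 'I_n * 'I_n) : R :=
  (if p.1 \in X then w 0 p.1 else 0) * (if p.2 \in X then 0 else w 0 p.2).

(** The eigenvalue equation on either side of the bipartition evaluates the form [S], as l P and as
    l Q, where P and Q are the squared norms of the halves of [w]. Hence P = Q. *)
Lemma eigenvector_crossprod (w : 'rV[R]_n) (l : R) :
  w *m A = l *: w -> w != 0 -> l != 0 ->
  exists P : R, [/\ 0 < P, \sum_p crossprod w p ^+ 2 = P ^+ 2 &
    \sum_p biadj p * crossprod w p = l * P].
Proof.
move=> wA w0 l0.
pose P := \sum_i (if i \in X then w 0 i else 0) ^+ 2.
pose Q := \sum_i (if i \in X then 0 else w 0 i) ^+ 2.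
set S := \sum_p biadj p * _.
have sym i j : A i j = A j i by rewrite -[in LHS]symA mxE.
have wAj j : l * w 0 j = \sum_i w 0 i * A i j.
  by have /(congr1 (fun u : 'rV_n => u 0 j)) := wA; rewrite !mxE.
have eS : S = \sum_i \sum_j (if i \in X then A i j else 0) *
    ((if i \in X then w 0 i else 0) * (if j \in X then 0 else w 0 j)).
  by rewrite pair_big.
have SP : l * P = S.
  rewrite eS mulr_sumr; apply: eq_bigr => i _; case: ifP => iX; last first.
    by rewrite expr0n mulr0 big1 // => j _; rewrite mul0r.
  rewrite expr2 mulrA wAj mulr_suml; apply: eq_bigr => j _.
  rewrite sym; have [->|/bipA] := eqVneq (A i j) 0;
    first by rewrite mulr0 !mul0r.
  by rewrite iX; case: ifP => // _ _; ring.
have SQ : l * Q = S.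
  rewrite eS exchange_big mulr_sumr; apply: eq_bigr => j _; case: ifP => jX.
    by rewrite expr0n mulr0 big1 // => i _; rewrite !mulr0.
  rewrite expr2 mulrA wAj mulr_suml; apply: eq_bigr => i _.
  have [->|/bipA] := eqVneq (A i j) 0; first by rewrite if_same mulr0 !mul0r.
  by rewrite jX; case: ifP => // _ _; ring.
have PQ : P = Q by apply: (mulfI l0); rewrite SP SQ.
exists P; split=> //.
  rewrite lt_def sumr_ge0 ?andbT => [|i _]; last exact: sqr_ge0.
  apply: contra_neq w0 => P0; apply/rowP => i; rewrite mxE.
  have /eqP := P0; rewrite psumr_eq0 => [/allP/(_ i)|? _]; last exact: sqr_ge0.
  have /eqP := P0; rewrite PQ psumr_eq0 => [/allP/(_ i)|? _];
    last exact: sqr_ge0.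
  rewrite mem_index_enum => /(_ isT) + /(_ isT).
  by rewrite !sqrf_eq0; case: ifP => _ /eqP + /eqP.
rewrite expr2 {2}PQ mulr_suml.
rewrite [RHS](eq_bigr _ (fun i _ => mulr_sumr _ _ _ _)) pair_big.
by apply: eq_bigr => p _; rewrite exprMn.
Qed.

End BipartiteEigenvector.

(** The negative sign makes the columns (s01, s21) and (s03, s23) orthogonal, so that the block is
    sqrt 2 times an orthogonal matrix. *)
Lemma negative_square_norm (R : realFieldType) (s01 s21 s23 s03 u0 u2 v1 v3 :
  R) :
  s01 ^+ 2 = 1 -> s21 ^+ 2 = 1 -> s23 ^+ 2 = 1 -> s03 ^+ 2 = 1 ->
  s01 * s21 * s23 * s03 = -1 ->
  (u0 * (s01 * v1 + s03 * v3) + u2 * (s21 * v1 + s23 * v3)) ^+ 2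
    <= 2 * ((u0 ^+ 2 + u2 ^+ 2) * (v1 ^+ 2 + v3 ^+ 2)).
Proof.
move=> h01 h21 h23 h03 neg.
have z : s01 * s03 + s21 * s23 = 0.
  apply/eqP; rewrite -sqrf_eq0.
  have -> : (s01 * s03 + s21 * s23) ^+ 2 =
    s01 ^+ 2 * s03 ^+ 2 + s21 ^+ 2 * s23 ^+ 2 + s01 * s21 * s23 * s03 *+ 2 by
      ring.
  by rewrite h01 h03 h21 h23 neg; apply/eqP; ring.
set r0 := s01 * v1 + _; set r2 := s21 * v1 + _.
have er : r0 ^+ 2 + r2 ^+ 2 = 2 * (v1 ^+ 2 + v3 ^+ 2).
  have -> : r0 ^+ 2 + r2 ^+ 2 = s01 ^+ 2 * v1 ^+ 2 + s03 ^+ 2 * v3 ^+ 2 +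
     s21 ^+ 2 * v1 ^+ 2 + s23 ^+ 2 * v3 ^+ 2 + (s01 * s03 + s21 * s23) * (v1 *
       v3) *+ 2.
    by rewrite /r0 /r2; ring.
  by rewrite h01 h03 h21 h23 z; ring.
rewrite -subr_ge0.
(* Lagrange's identity gives the defect in Cauchy-Schwarz as a square. *)
have -> : 2 * ((u0 ^+ 2 + u2 ^+ 2) * (v1 ^+ 2 + v3 ^+ 2)) -
  (u0 * r0 + u2 * r2) ^+ 2 = (r0 * u2 - r2 * u0) ^+ 2; last exact: sqr_ge0.
by rewrite mulrCA -er; ring.
Qed.

(* The optimal constant is [(2 cos (pi / 7))^2 = 3.24...]; what matters is that
   7/2 is below 4. *)
Lemma path6_norm (R : realFieldType) (s01 s21 s23 s43 s45 u0 u2 u4 v1 v3 v5 :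
  R) :
  s01 ^+ 2 = 1 -> s21 ^+ 2 = 1 -> s23 ^+ 2 = 1 -> s43 ^+ 2 = 1 -> s45 ^+ 2 = 1
    ->
  (u0 * (s01 * v1) + u2 * (s21 * v1 + s23 * v3) + u4 * (s43 * v3 + s45 * v5))
    ^+ 2
    <= 7 / 2 * ((u0 ^+ 2 + u2 ^+ 2 + u4 ^+ 2) * (v1 ^+ 2 + v3 ^+ 2 + v5 ^+ 2)).
Proof.
move=> h01 h21 h23 h43 h45.
set r0 := s01 * v1; set r2 := s21 * v1 + _; set r4 := s43 * v3 + _.
have CS : (u0 * r0 + u2 * r2 + u4 * r4) ^+ 2 <=
    (u0 ^+ 2 + u2 ^+ 2 + u4 ^+ 2) * (r0 ^+ 2 + r2 ^+ 2 + r4 ^+ 2).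
  rewrite -subr_ge0 [leRHS](_ : _ = (u0 * r2 - u2 * r0) ^+ 2 +
    (u0 * r4 - u4 * r0) ^+ 2 + (u2 * r4 - u4 * r2) ^+ 2); last by ring.
  by rewrite !addr_ge0 ?sqr_ge0.
apply: le_trans CS _; rewrite mulrCA ler_wpM2l ?addr_ge0 ?sqr_ge0 //.
rewrite -subr_ge0.
(* The squares are completed first in v1 and then in v3, leaving v1^2 / 2 and v5^2 / 2 to spare. *)
have -> : 7 / 2 * (v1 ^+ 2 + v3 ^+ 2 + v5 ^+ 2) - (r0 ^+ 2 + r2 ^+ 2 + r4 ^+ 2)
  =
   (v1 - s21 * s23 * v3) ^+ 2 + v1 ^+ 2 / 2 + (v3 - 2 * (s43 * s45) * v5) ^+ 2
     / 2
   + v5 ^+ 2 / 2.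
  have -> : r0 ^+ 2 + r2 ^+ 2 + r4 ^+ 2 = s01 ^+ 2 * v1 ^+ 2 + s21 ^+ 2 * v1 ^+
    2 +
     s23 ^+ 2 * v3 ^+ 2 + s43 ^+ 2 * v3 ^+ 2 + s45 ^+ 2 * v5 ^+ 2 +
     2 * (s21 * s23 * v1 * v3 + s43 * s45 * v3 * v5) by rewrite /r0 /r2 /r4;
       ring.
  have -> : (v1 - s21 * s23 * v3) ^+ 2 = v1 ^+ 2 - 2 * (s21 * s23 * v1 * v3) +
     s21 ^+ 2 * s23 ^+ 2 * v3 ^+ 2 by ring.
  have -> : (v3 - 2 * (s43 * s45) * v5) ^+ 2 = v3 ^+ 2 -
    4 * (s43 * s45 * v3 * v5) + 4 * (s43 ^+ 2 * s45 ^+ 2) * v5 ^+ 2 by ring.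
  by rewrite h01 h21 h23 h43 h45; field.
by do !apply: addr_ge0; rewrite ?divr_ge0 ?sqr_ge0 ?ler0n.
Qed.

Lemma big_pair_seq (R : nmodType) (I : finType) (s t : seq I) (F : I -> I -> R)
  :
  uniq s -> uniq t ->
  \sum_(p : I * I | (p.1 \in s) && (p.2 \in t)) F p.1 p.2 =
  \sum_(i <- s) \sum_(j <- t) F i j.
Proof.
move=> us ut; rewrite -(pair_big (mem s) (mem t)) big_uniq //=.
by apply: eq_bigr => i _; rewrite big_uniq.
Qed.

(** * Eigenvalue bounds from a negative cycle *)

Section EigenvalueBounds.
Variables (R : realFieldType) (n : nat) (A : 'M[R]_n) (X : {set 'I_n}).
Hypothesis symA : A^T = A.
Hypothesis bipA : forall i j, A i j != 0 -> (i \in X) != (j \in X).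
Hypothesis sqrA : forall i j, A i j != 0 -> A i j ^+ 2 = 1.
Hypothesis cardA : #|[set p | biadj A X p != 0]| = n.

Let biadj_sqr p : biadj A X p != 0 -> biadj A X p ^+ 2 = 1.
Proof. by rewrite /biadj; case: ifP => [_|]; rewrite ?eqxx //; exact: sqrA. Qed.

(** This is [block_cauchy_schwarz] for the block of the square, with c = 2. The equality clauses
    serve to find out how the other vertices are attached. *)
Lemma negative_square_eigenvalue (x0 x1 x2 x3 : 'I_n) (w : 'rV[R]_n) (l : R) :
  uniq [:: x0; x1; x2; x3] -> x0 \in X ->
  A x0 x1 != 0 -> A x2 x1 != 0 -> A x2 x3 != 0 -> A x0 x3 != 0 ->
  A x0 x1 * A x2 x1 * A x2 x3 * A x0 x3 = -1 ->
  w *m A = l *: w -> w != 0 -> l != 0 ->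
  l ^+ 2 <= n%:R - 2 /\
  (l ^+ 2 = n%:R - 2 ->
   (exists2 g, g != 0 & forall i j, i \in X -> j \notin X ->
     ~~ ((i \in [:: x0; x2]) && (j \in [:: x1; x3])) ->
     w 0 i * w 0 j = A i j * g) /\
   exists i j, [/\ i \in [:: x0; x2], j \in [:: x1; x3] & w 0 i * w 0 j != 0]).
Proof.
move=> ux X0 a01 a21 a23 a03 neg wA w0 l0.
have X1 : x1 \notin X by have := bipA a01; rewrite X0; case: (x1 \in X).
have X2 : x2 \in X by have := bipA a21; rewrite (negPf X1); case: (x2 \in X).
have X3 : x3 \notin X by have := bipA a23; rewrite X2; case: (x3 \in X).
have [P [P0 eP eS]] := eigenvector_crossprod symA bipA wA w0 l0.
have [u02 u13] : x0 != x2 /\ x1 != x3.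
  by move: ux; rewrite /= !inE !negb_or => /and4P[/and3P[_ -> _] /andP[_ ->]].
pose K (p : 'I_n * 'I_n) := (p.1 \in [:: x0; x2]) && (p.2 \in [:: x1; x3]).
have us : uniq [:: x0; x2] by rewrite /= inE u02.
have ut : uniq [:: x1; x3] by rewrite /= inE u13.
pose M := biadj A X; pose y := crossprod X w.
have KM : (\sum_(p | K p) M p * y p) = w 0 x0 * (A x0 x1 * w 0 x1 + A x0 x3 * w
  0 x3)
     + w 0 x2 * (A x2 x1 * w 0 x1 + A x2 x3 * w 0 x3).
  rewrite (big_pair_seq (fun i j => M (i, j) * y (i, j))) // !big_cons !big_nil.
  rewrite /M /y /biadj /crossprod /= X0 X2 (negPf X1) (negPf X3); ring.
have KY : (\sum_(p | K p) y p ^+ 2) =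
    (w 0 x0 ^+ 2 + w 0 x2 ^+ 2) * (w 0 x1 ^+ 2 + w 0 x3 ^+ 2).
  rewrite (big_pair_seq (fun i j => y (i, j) ^+ 2)) // !big_cons !big_nil.
  rewrite /y /crossprod /= X0 X2 (negPf X1) (negPf X3); ring.
have leK : (\sum_(p | K p) M p * y p) ^+ 2 <= 2 * \sum_(p | K p) y p ^+ 2.
  by rewrite KM KY negative_square_norm ?sqrA.
have [] := block_cauchy_schwarz biadj_sqr (ltr0n _ 2) leK.
(* The four edges of the square fill the block, so n - 4 edges remain outside. *)
have -> : 2 + #|[set p | ~~ K p & M p != 0]|%:R = n%:R - 2 :> R.
  pose F := [set p in [:: (x0, x1); (x0, x3); (x2, x1); (x2, x3)]].
  have -> : [set p | ~~ K p & M p != 0] = [set p | M p != 0] :\: F.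
    apply/setP => -[i j]; rewrite !inE /= /K /= !inE !xpair_eqE;
      congr (~~ _ && _).
    by case: (i == x0); case: (i == x2); case: (j == x1); case: (j == x3).
  rewrite cardsDS; last first.
    apply/fintype.subsetP => p; rewrite !inE /M /biadj.
    by case/or4P => /eqP ->; rewrite /= ?X0 ?X2.
  have F4 : #|F| = 4.
    rewrite cardsE; apply/card_uniqP.
    by rewrite /= !inE !xpair_eqE !eqxx ![x3 == _]eq_sym (negPf u02) (negPf
      u13).
  rewrite F4 cardA natrB; first ring.
  rewrite -F4 -[leqRHS]cardA; apply/subset_leq_card/fintype.subsetP => p;
    rewrite !inE /biadj.
  by case/or4P => /eqP ->; rewrite /= ?X0 ?X2.
rewrite -/y eP eS exprMn => le1 eq1; have P2 : 0 < P ^+ 2 by rewrite exprn_gt0.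
split=> [|e]; first by rewrite -(ler_pM2r P2).
have l2 : 0 < l ^+ 2 by rewrite exprn_even_gt0.
have [] := eq1 (congr1 (fun t => t * P ^+ 2) e); set g := _ / _ => h1 h2.
have g0 : g != 0.
  by rewrite /g !mulf_neq0 ?invr_eq0 -?e ?(gt_eqF P0) ?(gt_eqF l2).
split.
  exists g => // i j iX jX /(h1 (i, j)).
  by rewrite /y /M /crossprod /biadj /= iX (negPf jX).
(* The block contributes 2 g, which is nonzero, so some product in it is nonzero. *)
have : w 0 x0 * w 0 x1 != 0 \/ w 0 x0 * w 0 x3 != 0 \/ w 0 x2 * w 0 x1 != 0 \/
       w 0 x2 * w 0 x3 != 0.
  have := mulf_neq0 (_ : 2 != 0 :> R) g0; rewrite pnatr_eq0 => /(_ isT).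
  rewrite -h2 KM.
  have [e01|] := eqVneq (w 0 x0 * w 0 x1) 0; last by left.
  have [e03|] := eqVneq (w 0 x0 * w 0 x3) 0; last by right; left.
  have [e21|] := eqVneq (w 0 x2 * w 0 x1) 0; last by right; right; left.
  have [e23|] := eqVneq (w 0 x2 * w 0 x3) 0; last by right; right; right.
  by rewrite !mulrDr ![w 0 _ * (_ * _)]mulrCA e01 e03 e21 e23 !mulr0 !addr0
    eqxx.
by move=> [|[|[]]] ?; [exists x0, x1|exists x0, x3|exists x2, x1|exists x2, x3];
  split=> //; rewrite !inE eqxx ?orbT.
Qed.

(* Deleting the edge [v0 e] can only increase the quadratic form of [w]. It
   leaves [n - 1] edges, and the five edges of the path [v0 ... v5] count for
     7/2
   only: the bound is [(n - 6) + 7 / 2]. *)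
Lemma long_negative_cycle_eigenvalue (v0 v1 v2 v3 v4 v5 e : 'I_n) (w : 'rV[R]_n)
    (l : R) :
  uniq [:: v0; v1; v2; v3; v4; v5] -> e != v1 -> v0 \in X ->
  A v0 v1 != 0 -> A v2 v1 != 0 -> A v2 v3 != 0 -> A v4 v3 != 0 -> A v4 v5 != 0
    ->
  A v0 e != 0 -> A v0 v3 = 0 -> A v4 v1 = 0 -> A v2 v5 = 0 ->
  A v0 v5 = 0 \/ e = v5 -> A v0 e * (w 0 v0 * w 0 e) <= 0 ->
  w *m A = l *: w -> w != 0 -> 0 < l ->
  l ^+ 2 < n%:R - 2.
Proof.
move=> ux e1 X0 a01 a21 a23 a43 a45 a0e a03 a41 a25 a05 neg wA w0 l0.
have dist i j : (i < 6)%N -> (j < 6)%N ->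
    let s := [:: v0; v1; v2; v3; v4; v5] in
    (nth v0 s i == nth v0 s j) = (i == j).
  by move=> i6 j6; exact: nth_uniq.
have X1 : v1 \notin X by have := bipA a01; rewrite X0; case: (v1 \in X).
have X2 : v2 \in X by have := bipA a21; rewrite (negPf X1); case: (v2 \in X).
have X3 : v3 \notin X by have := bipA a23; rewrite X2; case: (v3 \in X).
have X4 : v4 \in X by have := bipA a43; rewrite (negPf X3); case: (v4 \in X).
have X5 : v5 \notin X by have := bipA a45; rewrite X4; case: (v5 \in X).
have Xe : e \notin X by have := bipA a0e; rewrite X0; case: (e \in X).
have [P [P0 eP eS]] := eigenvector_crossprod symA bipA wA w0 (lt0r_neq0 l0).
pose y := crossprod X w.
pose M p := if p == (v0, e) then 0 else biadj A X p.
pose s := [:: v0; v2; v4]; pose t := [:: v1; v3; v5].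
have us : uniq s by rewrite /= !inE (dist 0 2) // (dist 0 4) // (dist 2 4).
have ut : uniq t by rewrite /= !inE (dist 1 3) // (dist 1 5) // (dist 3 5).
pose K (p : 'I_n * 'I_n) := (p.1 \in s) && (p.2 \in t).
have M1 p : M p != 0 -> M p ^+ 2 = 1.
  by rewrite /M; case: ifP => [_|_ /biadj_sqr //]; rewrite eqxx.
(* In a 6-cycle the deleted edge is the one that closes the path; otherwise v0 and v5 are not
   adjacent. *)
have M05 : M (v0, v5) = 0.
  by rewrite /M /biadj /= X0; case: a05 => [->|->]; rewrite ?eqxx ?if_same.
have KM : (\sum_(p | K p) M p * y p) = w 0 v0 * (A v0 v1 * w 0 v1) +
    w 0 v2 * (A v2 v1 * w 0 v1 + A v2 v3 * w 0 v3) +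
    w 0 v4 * (A v4 v3 * w 0 v3 + A v4 v5 * w 0 v5).
  rewrite (big_pair_seq (fun i j => M (i, j) * y (i, j))) // !big_cons !big_nil.
  rewrite M05 /M /y /biadj /crossprod /= !xpair_eqE X0 X2 X4 (negPf X1) (negPf
    X3).
  rewrite (negPf X5) (dist 2 0) // (dist 4 0) // [v1 == e]eq_sym (negPf e1) /=.
  by rewrite andbF a03 a41 a25 if_same; ring.
have KY : (\sum_(p | K p) y p ^+ 2) =
    (w 0 v0 ^+ 2 + w 0 v2 ^+ 2 + w 0 v4 ^+ 2) *
    (w 0 v1 ^+ 2 + w 0 v3 ^+ 2 + w 0 v5 ^+ 2).
  rewrite (big_pair_seq (fun i j => y (i, j) ^+ 2)) // !big_cons !big_nil.
  rewrite /y /crossprod /= X0 X2 X4 (negPf X1) (negPf X3) (negPf X5); ring.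
have leK : (\sum_(p | K p) M p * y p) ^+ 2 <= 7 / 2 * \sum_(p | K p) y p ^+ 2.
  by rewrite KM KY path6_norm ?sqrA.
have c0 : 0 < 7 / 2 :> R by rewrite divr_gt0 ?ltr0n.
have [leS _] := block_cauchy_schwarz M1 c0 leK.
(* Neither the deleted edge nor the five path edges are counted here, and these six are distinct. *)
have le_card : (#|[set p | ~~ K p & (M p != 0)%R]| + 6 <= n)%N.
  pose fs := [:: (v0, e); (v0, v1); (v2, v1); (v2, v3); (v4, v3); (v4, v5)].
  have ufs : uniq fs.
    rewrite /= !inE !xpair_eqE (dist 0 2) // (dist 0 4) // (dist 2 4) //.
    by rewrite (dist 1 3) // (dist 3 5) // (negPf e1) !andbF.
  have sub_fs : [set p in fs] \subset [set p | biadj A X p != 0].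
    apply/fintype.subsetP => p; rewrite !inE /biadj.
    by do 5![case/orP => [/eqP -> /=|]; rewrite ?X0 ?X2 ?X4 //];
      move/eqP => -> /=; rewrite X4.
  have c6 : #|[set p in fs]| = 6 by rewrite cardsE; apply/card_uniqP.
  rewrite -[leqRHS]cardA -(cardsID [set p in fs] [set p | biadj A X p != 0]).
  rewrite addnC (finset.setIidPr sub_fs) c6 leq_add2l.
  apply/subset_leq_card/fintype.subsetP => -[i j]; rewrite !inE /M.
  case: ifP => [_|_]; first by rewrite eqxx andbF.
  move=> /andP[nK ->]; rewrite andbT !xpair_eqE.
  move: nK; rewrite /K /= !inE.
  by case: (i == v0); case: (i == v2); case: (i == v4);
     case: (j == v1); case: (j == v3); case: (j == v5).
have eS' : l * P = A v0 e * (w 0 v0 * w 0 e) + \sum_p M p * y p.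
  rewrite -eS (bigD1 (v0, e)) //= [in RHS](bigD1 (v0, e)) //= /M eqxx mul0r
    add0r.
  congr (_ + _); first by rewrite /biadj /crossprod /= X0 (negPf Xe).
  by apply: eq_bigr => p /negPf ->.
have lP : 0 < l * P by rewrite mulr_gt0.
have P2 : 0 < P ^+ 2 by rewrite exprn_gt0.
rewrite -(ltr_pM2r P2) -exprMn.
(* The dropped term is nonpositive, so the positive number l P is at most the remaining sum, and
   squaring keeps the order. *)
apply: (@le_lt_trans _ _ ((\sum_p M p * y p) ^+ 2)).
  by rewrite lerXn2r ?nnegrE; lra.
apply: le_lt_trans leS _; rewrite eP ltr_pM2r //.
move: le_card; rewrite -(ler_nat R) natrD; set m := _%:R; lra.
Qed.

End EigenvalueBounds.

(** * Unicyclic graphs *)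

(** The witness [d] is the distance to [c]. Walks are tuples so that having one of a given length is
    decidable and [ex_minn] applies. *)
Lemma decreasing_distance n (G : sgraph n) (c : seq 'I_n) (x : 'I_n) :
  Defs.connected G -> x \in c ->
  exists d : 'I_n -> nat, forall v, v \notin c -> exists2 u, G v u & (d u < d
    v)%N.
Proof.
move=> [_ conG] xc.
have reach v : exists m, [exists t : m.-tuple 'I_n, path G v t && (last v t \in
  c)].
  have /connectP[t Gt ex] := conG v x.
  exists (size t); apply/existsP; exists (in_tuple t).
  by rewrite Gt -ex xc.
exists (fun v => ex_minn (reach v)) => v vc.
case: (ex_minnP (reach v)) => -[|m] /existsP[t /andP[Gt tc]] _.
  by rewrite (tuple0 t) /= (negPf vc) in tc.
case/tupleP: t Gt tc => u t /= /andP[Gvu Gt] tc; exists u => //.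
case: ex_minnP => k _; rewrite ltnS; apply.
by apply/existsP; exists t; rewrite Gt.
Qed.

(* Off the cycle [p] moves towards it, so that [v |-> {v, p v}] is injective;
   as there are [n] edges, it reaches all of them. *)
Lemma unicyclic_parent n (G : sgraph n) (c : seq 'I_n) :
  unicyclic G -> cycle_of G c ->
  exists p : 'I_n -> 'I_n, [/\ {in c, p =1 next c}, (forall v, p (p v) != v) &
    forall u v, G u v = (p u == v) || (p v == u)].
Proof.
move=> [conG nE] [size_c /andP[cyc_c uniq_c]].
have [x xc] : exists x, x \in c by case: (c) size_c => // x s _; exists x;
  rewrite mem_head.
have [d dP] := decreasing_distance conG xc.
pose p v := if v \in c then next c v else odflt v [pick u | G v u && (d u < d
  v)%N].
have p_c v : v \in c -> p v = next c v by rewrite /p => ->.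
have p_d v : v \notin c -> G v (p v) && (d (p v) < d v)%N.
  move=> vc; rewrite /p (negPf vc); case: pickP => //= none.
  by have [u Gvu du] := dP v vc; have := none u; rewrite Gvu du.
have Gp v : G v (p v).
  have [vc|/p_d/andP[]//] := boolP (v \in c).
  by rewrite p_c // next_cycle.
have next2 v : v \in c -> next c (next c v) != v.
  move=> vc; have [i s ds] := rot_to vc.
  have us : uniq (v :: s) by rewrite -ds rot_uniq.
  rewrite -!(next_rot i uniq_c) ds.
  have : (3 <= size (v :: s))%N by rewrite -ds size_rot.
  case: s {ds} us => [|a [|b s]] //= /and3P[va ab _] _.
  rewrite eqxx; move: va; rewrite !inE !negb_or => /and3P[va vb _].
  by rewrite [a == v]eq_sym (negPf va) eqxx eq_sym.
(* The map [p] preserves the cycle, where its length of at least 3 is used; off the cycle [p]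
   decreases [d]. *)
have pp v : p (p v) != v.
  have [vc|vc] := boolP (v \in c); first by rewrite !p_c ?mem_next ?next2.
  apply/eqP => e; have [pvc|pvc] := boolP (p v \in c).
    by move: vc; rewrite -e p_c // mem_next pvc.
  have /andP[_] := p_d _ pvc; have /andP[_ lt1] := p_d _ vc.
  by rewrite e ltnNge ltnW.
have inj : injective (fun v => [set v; p v]).
  move=> u v euv; apply/eqP; apply/negPn/negP => nuv.
  have : u \in [set v; p v] by rewrite -euv set21.
  rewrite !inE (negPf nuv) /= => /eqP eu.
  have : v \in [set u; p u] by rewrite euv set21.
  rewrite !inE eq_sym (negPf nuv) /= => /eqP ev.
  by have := pp u; rewrite -ev -eu eqxx.
exists p; split=> // u v.
have imE : [set [set v; p v] | v : 'I_n] = edges G.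
  apply/eqP; rewrite eqEcard (card_imset _ inj) nE card_ord leqnn andbT.
  apply/fintype.subsetP => _ /imsetP[z _ ->]; apply/imsetP;
    exists (z, p z) => //.
  by rewrite inE.
apply/idP/orP => [Guv|[/eqP <-|/eqP <-]]; rewrite ?Gp // 1?adj_sym ?Gp //.
have : [set u; v] \in edges G by apply/imsetP; exists (u, v); rewrite ?inE.
rewrite -imE => /imsetP[z _ ez].
have nuv : u != v by apply: contraTneq Guv => ->; rewrite adj_irrefl.
have := set21 u v; have := set22 u v; rewrite ez !inE.
case/orP => /eqP ev /orP[] /eqP eu; rewrite eu ev ?eqxx; auto.
all: by move: nuv; rewrite eu ev eqxx.
Qed.

(** The map [h] sends v to the edge between v and [p v], written with its endpoint in [X] first; it
    is a bijection from the vertices to these pairs. *)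
Lemma card_parent_edges n (X : {set 'I_n}) (p : 'I_n -> 'I_n) :
  (forall v, p (p v) != v) -> (forall v, (v \in X) != (p v \in X)) ->
  #|[set q : 'I_n * 'I_n | (q.1 \in X) && ((p q.1 == q.2) || (p q.2 == q.1))]|
    = n.
Proof.
move=> pp pX.
pose h v := if v \in X then (v, p v) else (p v, v).
have inj : injective h.
  move=> u v; rewrite /h; case: ifP => _; case: ifP => _ [] //.
    by move=> -> /eqP; rewrite (negPf (pp v)).
  by move=> <- /esym /eqP; rewrite (negPf (pp u)).
rewrite -[RHS]card_ord -cardsT -(card_imset _ inj); congr #|pred_of_set _|.
apply/setP => -[i j]; rewrite inE /=; apply/andP/imsetP.
  move=> [iX /orP[] /eqP e].
    by exists i => //; rewrite /h iX e.
  exists j => //; rewrite /h e; case: ifP => // jX.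
  by have := pX j; rewrite jX e iX.
move=> [v _]; rewrite /h; case: ifP => vX [-> ->]; first by rewrite vX eqxx.
by have := pX v; rewrite vX eqxx orbT; case: (p v \in X).
Qed.

Lemma next_nthS (T : eqType) (x0 : T) (s : seq T) i :
  uniq s -> (i.+1 < size s)%N -> next s (nth x0 s i) = nth x0 s i.+1.
Proof.
move=> us lt_i; rewrite next_nth mem_nth 1?ltnW // index_uniq 1?ltnW //.
by case: s us lt_i => //= y s _ lt_i; apply: set_nth_default.
Qed.

Lemma next_last (T : eqType) (x : T) (s : seq T) :
  uniq (x :: s) -> next (x :: s) (last x s) = x.
Proof.
move=> us; rewrite next_nth mem_last index_last //.
(* The index of the last entry is past the end of [s], and the default there is the head [x]. *)
by rewrite nth_default.
Qed.

(** * Switching and the spectrum *)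

(** Removing the edge x1 x2 leaves a spanning tree, whose edges can all be switched to positive; the
    sign of the cycle then forces x1 x2 to be negative. *)
Lemma switching_gamma4neg n (G : signed_graph n) (x0 x1 x2 x3 : 'I_n)
    (p : 'I_n -> 'I_n) :
  (forall u v, ugraph G u v = (p u == v) || (p v == u)) ->
  uniq [:: x0; x1; x2; x3] ->
  p x0 = x1 -> p x1 = x2 -> p x2 = x3 -> p x3 = x0 ->
  (forall v, v \notin [:: x0; x1; x2; x3] -> p v = x0) ->
  sigma G x0 x1 * sigma G x1 x2 * sigma G x2 x3 * sigma G x3 x0 = -1 ->
  switching_equivalent G (gamma4neg n).
Proof.
move=> Gp uc p0 p1 p2 p3 pout neg.
pose c := [:: x0; x1; x2; x3].
(* The relabelling is the position in this list: the cycle gets 0 to 3 and the pendant vertices the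
   rest. *)
pose s := c ++ [seq v <- enum 'I_n | v \notin c].
have us : uniq s.
  rewrite cat_uniq uc filter_uniq ?enum_uniq // andbT.
  by apply/hasPn => v; rewrite mem_filter => /andP[].
have ms v : v \in s.
  by rewrite mem_cat mem_filter mem_enum andbT orbN.
have size_s : size s = n.
  by rewrite -(card_uniqP us) -[RHS]card_ord; apply: eq_card => v; rewrite ms.
have lt_s v : (index v s < n)%N by rewrite -{2}size_s index_mem.
have injf : injective (fun v => Ordinal (lt_s v)).
  move=> u v /(congr1 val) e.
  by rewrite -(nth_index u (ms u)) [index u s]e nth_index.
pose f := perm injf.
have fE v : val (f v) = index v s by rewrite permE.
have ne i j : (i < 4)%N -> (j < 4)%N -> (nth x0 c i == nth x0 c j) = (i == j).
  by move=> *; apply: nth_uniq.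
have n01 : x0 == x1 = false := ne 0 1 isT isT.
have n02 : x0 == x2 = false := ne 0 2 isT isT.
have n03 : x0 == x3 = false := ne 0 3 isT isT.
have n10 : x1 == x0 = false := ne 1 0 isT isT.
have n12 : x1 == x2 = false := ne 1 2 isT isT.
have n13 : x1 == x3 = false := ne 1 3 isT isT.
have n20 : x2 == x0 = false := ne 2 0 isT isT.
have n21 : x2 == x1 = false := ne 2 1 isT isT.
have n23 : x2 == x3 = false := ne 2 3 isT isT.
have n30 : x3 == x0 = false := ne 3 0 isT isT.
have n31 : x3 == x1 = false := ne 3 1 isT isT.
have n32 : x3 == x2 = false := ne 3 2 isT isT.
have nE := (n01, n02, n03, n12, n13, n23, n10, n20, n21, n30, n31, n32, eqxx).
have f0 : val (f x0) = 0%N by rewrite fE /= nE.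
have f1 : val (f x1) = 1%N by rewrite fE /= !nE.
have f2 : val (f x2) = 2%N by rewrite fE /= !nE.
have f3 : val (f x3) = 3%N by rewrite fE /= !nE.
have fout v : v \notin c -> exists k, val (f v) = k.+4.
  by move=> vc; rewrite fE index_cat (negPf vc); eexists.
have cases v : [\/ v = x0, v = x1, v = x2 | v = x3] \/ v \notin c.
  have [|vc] := boolP (v \in c); last by right.
  by rewrite !inE => /or4P[] /eqP ->; left; constructor.
have out w : w \notin c -> [/\ (x0 == w) = false, (x1 == w) = false,
    (x2 == w) = false & (x3 == w) = false].
  rewrite !inE !negb_or ![w == _]eq_sym.
  by move=> /and4P[] /negPf -> /negPf -> /negPf -> /negPf ->.
have arcE u v : gamma4_arc (f u) (f v) || gamma4_arc (f v) (f u) =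
    (p u == v) || (p v == u).
  case: (cases u) => [[->|->|->|->]|uc'];
    case: (cases v) => [[->|->|->|->]|vc'];
  rewrite ?p0 ?p1 ?p2 ?p3 ?nE -?[nat_of_ord _]/(val _) ?f0 ?f1 ?f2 ?f3 //.
  all: try (have [] := out _ uc'; move=> o0 o1 o2 o3).
  all: try (have [] := out _ vc'; move=> q0 q1 q2 q3).
  all: try have [i ->] := fout _ uc'.
  all: try have [j ->] := fout _ vc'.
  all: rewrite ?(pout _ uc') ?(pout _ vc').
  all: rewrite ?o0 ?o1 ?o2 ?o3 ?q0 ?q1 ?q2 ?q3 ?nE.
  all: rewrite /gamma4_arc /=.
  all: try by [].
(* A vertex is switched when its tree path from x0 is negative. Only x2 is not a neighbour of x0,
   and its path goes through x3. *)
pose Z := [set v | (v != x0) &&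
  (if v == x2 then sigma G x0 x3 * sigma G x2 x3 == -1 else sigma G x0 v ==
    -1)].
have sE u v : p u = v -> sigma G u v = 1 \/ sigma G u v = -1.
  by move=> e; apply: sigma_sign; rewrite Gp e eqxx.
have sigE v : gamma4_sigma (f v) (f (p v)) = switch_sigma Z G v (p v).
  have s01 := sE _ _ p0; have s12 := sE _ _ p1; have s23 := sE _ _ p2.
  have s30 := sE _ _ p3.
  rewrite /gamma4_sigma /switch_sigma !inE.
  have [[->|->|->|->]|vc] := cases v.
  - rewrite p0 f0 f1 !nE /=.
    by case: s01 => ->.
  - rewrite p1 f1 f2 !nE /= (sigma_sym G x0 x3).
    by case: s01 neg => ->; case: s12 => ->; case: s23 => ->; case: s30 => ->.
  - rewrite p2 f2 f3 !nE /= (sigma_sym G x0 x3).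
    by case: s23 => ->; case: s30 => ->.
  - rewrite p3 f3 f0 !nE /= (sigma_sym G x0 x3).
    by case: s30 => ->.
  have pv := pout _ vc; have := sE _ _ pv.
  have [o0 _ o2 _] := out _ vc; have [k ->] := fout _ vc.
  rewrite pv f0 !nE /= ![v == _]eq_sym o0 o2 /= (sigma_sym G x0 v).
  by case=> ->.
exists Z, f; split=> [u v|u v /=]; first by rewrite [RHS]Gp -arcE.
rewrite Gp => /orP[] /eqP <-; first exact: sigE.
by rewrite gamma4_sigma_sym switch_sigma_sym sigE.
Qed.

(** The list [spectrum] is chosen from the characteristic polynomial alone, so equal polynomials
    yield the same list. *)
Lemma EE_conj (R : realType) n (G H : signed_graph n) (P : 'M[R]_n) :
  P \in unitmx -> P *m adjacency R G = adjacency R H *m P -> EE R G = EE R H.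
Proof.
by move=> uP PG; rewrite /EE /spectrum /is_spectrum (char_poly_conj uP PG).
Qed.

(** Conjugation by this matrix realizes switching at [X]; when [X] is a side of a bipartition, it
    negates the adjacency matrix. *)
Definition sign_mx (R : realType) n (X : {set 'I_n}) : 'M[R]_n :=
  diag_mx (\row_i (-1) ^+ (i \in X)).

Lemma sign_mx_unit (R : realType) n (X : {set 'I_n}) : sign_mx R X \in unitmx.
Proof.
suff /mulmx1_unit[] : sign_mx R X *m sign_mx R X = 1%:M by [].
rewrite mulmx_diag -diag_const_mx; congr diag_mx.
by apply/rowP => i; rewrite !mxE -expr2 sqrr_sign.
Qed.

Lemma EE_switching (R : realType) n (G H : signed_graph n) :
  switching_equivalent G H -> EE R G = EE R H.
Proof.
move=> [Z [f [adj_f sigma_f]]]; transitivity (EE R (switch Z G)).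
  apply: (EE_conj (sign_mx_unit R Z)).
  apply/matrixP => i j; rewrite mul_diag_mx mul_mx_diag !mxE /=.
  case: ifP => _; last by rewrite mulr0 mul0r.
  rewrite /switch_sigma; case: (i \in Z); case: (j \in Z) => /=;
  by rewrite ?expr1 ?expr0 ?mulN1r ?mulrN1 ?mul1r ?mulr1 ?rmorphN ?opprK.
apply: (@EE_conj _ _ _ _ (perm_mx f^-1)); first exact: unitmx_perm.
rewrite -row_permE -col_permE; apply/matrixP => i j.
have [u ->] : exists u, i = f u by exists ((f^-1)%g i); rewrite permKV.
rewrite !mxE permK adj_f; case: ifP => // Guj.
by rewrite sigma_f.
Qed.

Lemma char_poly_adjacencyN (R : realType) n (G : signed_graph n) (X : {set
  'I_n}) :
  (forall u v, ugraph G u v -> (u \in X) != (v \in X)) ->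
  char_poly (adjacency R G) = char_poly (- adjacency R G).
Proof.
move=> bipX; apply: (char_poly_conj (sign_mx_unit R X)).
apply/matrixP => i j; rewrite mul_diag_mx mul_mx_diag !mxE /=.
case: ifP => [/bipX|_]; last by rewrite oppr0 mulr0 mul0r.
case: (i \in X); case: (j \in X) => //= _;
by rewrite ?expr1 ?expr0 ?mulN1r ?mulrN1 ?mul1r ?mulr1 ?opprK.
Qed.

Lemma spectrum_symmetric (R : realType) n (G : signed_graph n) (X : {set 'I_n})
  :
  (forall u v, ugraph G u v -> (u \in X) != (v \in X)) ->
  perm_eq (spectrum (adjacency R G)) [seq - x | x <- spectrum (adjacency R G)].
Proof.
move=> bipX; have sP := spectrumP (tr_adjacency R G).
apply: perm_eq_prod_XaddC; rewrite -[LHS]sP (char_poly_adjacencyN R bipX).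
exact: char_polyN_split sP.
Qed.

Lemma size_spectrum (R : realType) n (G : signed_graph n) :
  size (spectrum (adjacency R G)) = n.
Proof.
apply/eq_add_S; rewrite -[RHS](size_char_poly (adjacency R G)).
by rewrite (spectrumP (tr_adjacency R G)) size_prod_XsubC.
Qed.

Lemma mem_spectrum (R : realType) n (G : signed_graph n) (l : R) :
  (l \in spectrum (adjacency R G)) = eigenvalue (adjacency R G) l.
Proof.
by rewrite eigenvalue_root_char (spectrumP (tr_adjacency R G)) root_prod_XsubC.
Qed.

Lemma adjacency_eq0 (R : realType) n (G : signed_graph n) i j :
  (adjacency R G i j == 0) = ~~ ugraph G i j.
Proof.
by rewrite mxE; case: ifP => [/sigma_sign[] ->|]; rewrite ?eqxx // intr_eq0.
Qed.

Lemma adjacency_sqr (R : realType) n (G : signed_graph n) i j :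
  adjacency R G i j ^+ 2 = (ugraph G i j)%:R.
Proof.
rewrite mxE; case: ifP => [/sigma_sign[] ->|]; rewrite ?expr0n ?expr1n //.
by rewrite rmorphN sqrrN expr1n.
Qed.

(** The trace of the squared adjacency matrix counts ordered adjacent pairs. Each has exactly one of
    the forms (v, p v) and (p v, v). *)
Lemma sum_sqr_spectrum (R : realType) n (G : signed_graph n) (p : 'I_n -> 'I_n)
  :
  (forall v, p (p v) != v) ->
  (forall u v, ugraph G u v = (p u == v) || (p v == u)) ->
  \sum_(x <- spectrum (adjacency R G)) x ^+ 2 = (n%:R : R) *+ 2.
Proof.
move=> pp Gp; rewrite (mxtrace_sqr_split (spectrumP (tr_adjacency R G))).
have -> : \tr (adjacency R G *m adjacency R G) =
    \sum_i \sum_j ((p i == j)%:R + (p j == i)%:R).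
  apply: eq_bigr => i _; rewrite mxE; apply: eq_bigr => j _.
  have -> : adjacency R G j i = adjacency R G i j by rewrite -[in
    LHS]tr_adjacency mxE.
  rewrite -expr2 adjacency_sqr Gp.
  have [<-|_] := eqVneq (p i) j; last by rewrite add0r.
  by rewrite (negPf (pp i)) addr0.
rewrite (eq_bigr _ (fun i _ => big_split _ _ _ _ _)) big_split /= mulr2n.
have half : \sum_i \sum_j (p i == j)%:R = n%:R :> R.
  rewrite -[in RHS](card_ord n) -sumr_const; apply: eq_bigr => i _.
  rewrite (bigD1 (p i)) //= eqxx big1 ?addr0 // => j.
  by rewrite eq_sym => /negPf ->.
by congr (_ + _) => //; rewrite exchange_big.
Qed.

(** * Moments of spectra symmetric about zero, and the extremal graph *)

Lemma sum_odd_symmetric (R : numDomainType) (s : seq R) k :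
  perm_eq s [seq - x | x <- s] -> odd k -> \sum_(x <- s) x ^+ k = 0.
Proof.
move=> ps ok; set S := LHS.
have : S = - S.
  rewrite {1}/S (perm_big _ ps) big_map -sumrN; apply: eq_bigr => x _.
  by rewrite exprNn -signr_odd ok expr1 mulN1r.
by move/eqP; rewrite -subr_eq0 opprK -mulr2n mulrn_eq0 /= => /eqP.
Qed.

Lemma sum_even_symmetric (R : realDomainType) (s : seq R) k :
  perm_eq s [seq - x | x <- s] -> (0 < k)%N ->
  \sum_(x <- s) x ^+ k.*2 = (\sum_(y <- [seq x ^+ 2 | x <- s & 0 < x]) y ^+ k)
    *+ 2.
Proof.
move=> ps k0; rewrite (bigID (fun x => 0 < x)) /= mulr2n big_map big_filter.
have e2 (x : R) : x ^+ k.*2 = (x ^+ 2) ^+ k by rewrite -mul2n exprM.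
congr (_ + _); first by apply: eq_bigr.
rewrite (perm_big _ ps) big_map big_mkcond [RHS]big_mkcond /=.
apply: eq_bigr => x _; rewrite e2 sqrrN oppr_gt0.
by case: ltrgt0P => // ->; rewrite expr0n /= expr0n gtn_eqF.
Qed.

Lemma size_positive_symmetric (R : realDomainType) (s : seq R) :
  perm_eq s [seq - x | x <- s] -> ((size [seq x <- s | (0 < x)%R]).*2 <= size
    s)%N.
Proof.
move=> ps; rewrite size_filter -addnn {2}(seq.permP ps) count_map.
rewrite -(count_predC (fun x : R => 0 < x) s) leq_add2l;
  apply: sub_count => x /=.
by rewrite oppr_gt0 => /ltW; rewrite leNgt.
Qed.

(* The eigenvector is [(a, b, c, d)] on the 4-cycle and [t] on the pendant
   vertices. *)
Lemma gamma4neg_eigenvalue (R : realType) k (a b c d t l : R) :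
  b + d + k%:R * t = l * a -> a - c = l * b -> d - b = l * c -> a + c = l * d ->
  a = l * t -> b != 0 -> eigenvalue (adjacency R (gamma4neg k.+4)) l.
Proof.
move=> e0 e1 e2 e3 et b0.
pose f (i : nat) := match i with 0 => a | 1 => b | 2 => c | 3 => d | _ => t end.
apply/eigenvalueP; exists (\row_(j < k.+4) f j); last first.
  apply: contra_neq b0 => /rowP/(_ (@Ordinal k.+4 1 isT)).
  by rewrite !mxE.
apply/rowP => j; rewrite !mxE.
have tail (F : nat -> R) : \sum_(i < k.+4) F i =
    F 0 + F 1 + F 2 + F 3 + \sum_(i < k) F i.+4.
  by rewrite !big_ord_recl /= !addrA; congr (_ + _); apply: eq_bigr.
pose B (i j : nat) : R := if gamma4_arc i j || gamma4_arc j i then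
  (if (i, j) \in [:: (1, 2); (2, 1)]%N then -1 else 1) else 0.
rewrite (eq_bigr (fun i : 'I_k.+4 => f i * B i j)) => [|i _]; last first.
  rewrite !mxE /= /gamma4_adj /gamma4_sigma /B; case: ifP => // _.
  by case: ifP.
rewrite (tail (fun i => f i * B i j)).
case: j => -[|[|[|[|j]]]] lt_j /=; rewrite /B /=.
- rewrite sumr_const card_ord -mulr_natl; move: e0 => /=; lra.
- by rewrite big1 => [|i _]; [lra|rewrite mulr0].
- by rewrite big1 => [|i _]; [lra|rewrite mulr0].
- by rewrite big1 => [|i _]; [lra|rewrite mulr0].
- by rewrite big1 => [|i _]; [lra|rewrite mulr0].
Qed.

Lemma gamma4neg_bipartite n (u v : 'I_n) : ugraph (gamma4neg n) u v ->
  (u \in [set i : 'I_n | val i \in [:: 0; 2]%N]) !=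
  (v \in [set i : 'I_n | val i \in [:: 0; 2]%N]).
Proof.
rewrite !inE /= /gamma4_adj /gamma4_arc.
by case: u v => -[|[|[|[|u]]]] ? [[|[|[|[|v]]]] ?].
Qed.

Lemma sumr_exp_ge_two (R : realDomainType) (s : seq R) (a b : R) k :
  (forall y, y \in s -> 0 <= y) -> a \in s -> b \in s -> a != b ->
  a ^+ k + b ^+ k <= \sum_(y <- s) y ^+ k.
Proof.
move=> s0 sa sb ab; rewrite (perm_big _ (perm_to_rem sa)) big_cons /= lerD2l.
have sb' : b \in rem a s.
  by have := perm_mem (perm_to_rem sa) b; rewrite sb inE eq_sym (negPf ab).
rewrite (perm_big _ (perm_to_rem sb')) big_cons /= lerDl big_seq sumr_ge0 // =>
  y.
by move=> /mem_rem/mem_rem/s0 y0; rewrite exprn_ge0.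
Qed.

(** A lower bound suffices for the comparison, so it is enough to exhibit sqrt (n - 2) and sqrt 2 as
    eigenvalues; they are distinct since n > 4. *)
Lemma gamma4neg_power_sum (R : realType) n k : (4 < n)%N -> (0 < k)%N ->
  ((n%:R - 2) ^+ k + 2 ^+ k) *+ 2 <=
  \sum_(x <- spectrum (adjacency R (gamma4neg n))) x ^+ k.*2.
Proof.
move=> n4 k0; set s := spectrum _.
have n4R : 4 < n%:R :> R by rewrite ltr_nat.
rewrite (sum_even_symmetric (spectrum_symmetric R (@gamma4neg_bipartite n))) //.
have root_mem (m : R) : 0 < m -> eigenvalue (adjacency R (gamma4neg n))
  (Num.sqrt m) ->
    m \in [seq x ^+ 2 | x <- s & 0 < x].
  move=> m0 em; rewrite -[m]sqr_sqrtr ?ltW //; apply: map_f.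
  by rewrite mem_filter sqrtr_gt0 m0 mem_spectrum.
rewrite lerMn2r /=; apply: sumr_exp_ge_two.
- by move=> y /mapP[x _ ->]; apply: sqr_ge0.
- apply: root_mem; first lra.
  case: n n4 {s} n4R => [|[|[|[|m]]]] // _ n4R.
  set l := Num.sqrt _;
    have l2 : l * l = m.+4%:R - 2 by rewrite -expr2 sqr_sqrtr //; lra.
  (* This vector is constant on the neighbours of the center and vanishes at the vertex opposite to
     it. *)
  apply: (@gamma4neg_eigenvalue _ _ l 1 0 1 1); rewrite ?oner_eq0 ?l2 //; ring.
- apply: root_mem; first lra.
  case: n n4 {s} n4R => [|[|[|[|m]]]] // _ n4R.
  set l := Num.sqrt _; have l2 : l * l = 2 by rewrite -expr2 sqr_sqrtr.
  (* This vector vanishes at the center and at the pendant vertices. *)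
  apply: (@gamma4neg_eigenvalue _ _ 0 1 (- l) (-1) 0);
    rewrite ?oner_eq0 ?mulrN ?l2 //; ring.
- by apply/eqP; lra.
Qed.

Lemma EE_lt_gamma4neg (R : realType) n (G : signed_graph n) (X : {set 'I_n})
    (p : 'I_n -> 'I_n) :
  (4 < n)%N -> (forall v, p (p v) != v) ->
  (forall u v, ugraph G u v = (p u == v) || (p v == u)) ->
  (forall u v, ugraph G u v -> (u \in X) != (v \in X)) ->
  (forall l, eigenvalue (adjacency R G) l -> 0 < l -> l ^+ 2 < n%:R - 2) ->
  EE R G < EE R (gamma4neg n).
Proof.
move=> n4 pp Gp bipX bound.
have sym_s := spectrum_symmetric R bipX; set s := spectrum _ in sym_s.
have sym_t := spectrum_symmetric R (@gamma4neg_bipartite n).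
set t := spectrum _ in sym_t.
pose Y := [seq x ^+ 2 | x <- s & 0 < x].
have Yb y : y \in Y -> 0 <= y < n%:R - 2.
  move=> /mapP[x + ->]; rewrite mem_filter => /andP[x0 xs].
  by rewrite sqr_ge0 bound // -mem_spectrum.
have sumY : \sum_(y <- Y) y = n%:R.
  have := sum_even_symmetric sym_s (isT : (0 < 1)%N).
  rewrite (sum_sqr_spectrum R pp Gp) -/Y => /eqP.
  rewrite eqrMn2r // => /eqP ->.
  by apply: eq_bigr => y _; rewrite expr1.
have sizeY : (size Y).*2%:R <= n%:R :> R.
  by rewrite ler_nat size_map -(size_spectrum R G) size_positive_symmetric.
have n4R : 4 < n%:R :> R by rewrite ltr_nat.
have [leY ltY] := sumr_exp_le_majorized n4R Yb sumY sizeY.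
(* Strictness for the squares of the entries of [Y] is strictness for the fourth moment of the
   spectrum. *)
apply: (@lt_sum_expR _ _ _ 4) => [k|].
  have [ok|ek] := boolP (odd k).
    by rewrite (sum_odd_symmetric sym_s) // (sum_odd_symmetric sym_t).
  (* The moment of order 0 is apart: it counts the zero eigenvalues too, and is n for both
     graphs. *)
  rewrite -(even_halfK ek); case: (posnP k./2) => [->|k0].
    have M0 (r : seq R) : \sum_(x <- r) x ^+ 0 = (size r)%:R.
      by rewrite -sum1_size natr_sum.
    by rewrite double0 !M0 !size_spectrum.
  apply: le_trans (gamma4neg_power_sum R n4 k0).
  by rewrite (sum_even_symmetric sym_s) // lerMn2r /= leY.
apply: lt_le_trans (gamma4neg_power_sum R n4 (isT : (0 < 2)%N)).
by rewrite (sum_even_symmetric (k := 2) sym_s) // ltrMn2r /=.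
Qed.

(** * Bounding the eigenvalues *)

Lemma cycle_sign_rot n (G : signed_graph n) (c : seq 'I_n) i :
  uniq c -> cycle_sign G (rot i c) = cycle_sign G c.
Proof.
move=> uc; rewrite /cycle_sign (perm_big c) ?perm_rot //=.
by apply: eq_bigr => x _; rewrite next_rot.
Qed.

Lemma unbalanced_cycle n (G : signed_graph n) :
  ~ balanced G -> exists2 c, cycle_of (ugraph G) c & cycle_sign G c = -1.
Proof.
move=> unbal; apply: contrapT => none; apply: unbal => c cycG.
have [//|neg] : cycle_sign G c = 1 \/ cycle_sign G c = -1; last by case: none;
  exists c.
have [_ /andP[cyc _]] := cycG.
rewrite /cycle_sign big_seq; elim/big_ind: _ => [|a b|x xc]; first by left.
  by move=> [] -> [] ->; rewrite ?mulr1 ?mul1r ?mulrNN ?mulr1; auto.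
exact/sigma_sign/next_cycle.
Qed.

Lemma bipartition_at n (G : sgraph n) (x : 'I_n) : bipartite G ->
  exists2 X : {set 'I_n}, x \in X & forall u v, G u v -> (u \in X) != (v \in X).
Proof.
move=> [X bipX]; have [xX|xX] := boolP (x \in X); first by exists X.
exists (~: X) => [|u v /bipX]; first by rewrite inE.
by rewrite !inE; case: (u \in X); case: (v \in X).
Qed.

Section Unicyclic.
Variables (R : realType) (n : nat) (G : signed_graph n) (p : 'I_n -> 'I_n).
Hypothesis pp : forall v, p (p v) != v.
Hypothesis Gp : forall u v, ugraph G u v = (p u == v) || (p v == u).
Hypothesis bipG : bipartite (ugraph G).

Let A := adjacency R G.

Let A0 i j : (A i j != 0) = ugraph G i j.
Proof. by rewrite /A adjacency_eq0 negbK. Qed.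

Let symA i j : A i j = A j i.
Proof. by rewrite /A -[in LHS]tr_adjacency mxE. Qed.

Let A1 i j : A i j != 0 -> A i j ^+ 2 = 1.
Proof. by rewrite A0 /A adjacency_sqr => ->. Qed.

Let Gv v : ugraph G v (p v).
Proof. by rewrite Gp eqxx. Qed.

Lemma card_biadj (X : {set 'I_n}) :
  (forall u v, ugraph G u v -> (u \in X) != (v \in X)) ->
  #|[set q | biadj A X q != 0]| = n.
Proof.
move=> bipX; rewrite -[RHS](@card_parent_edges n X p) // => [|v];
  last exact: bipX.
congr #|pred_of_set _|; apply/setP => q; rewrite !inE /biadj.
by case: ifP => _; rewrite ?eqxx // A0 Gp.
Qed.

(** Each vertex lies on two edges of the cycle, so the product of these terms is the sign of the
    cycle times a square; hence they are not all positive. *)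
Lemma nonpositive_cycle_edge (c : seq 'I_n) (w : 'rV[R]_n) :
  uniq c -> {in c, p =1 next c} -> cycle_sign G c = -1 ->
  exists2 x, x \in c & A x (p x) * (w 0 x * w 0 (p x)) <= 0.
Proof.
move=> uc pc neg; apply: contrapT => none.
have pos x : x \in c -> 0 < A x (next c x) * (w 0 x * w 0 (next c x)).
  move=> xc; rewrite -pc // ltNge; apply/negP => le0.
  by apply: none; exists x.
have : 0 < \prod_(x <- c) (A x (next c x) * (w 0 x * w 0 (next c x))).
  by rewrite big_seq; apply: prodr_gt0.
rewrite !big_split /= -(big_map (next c) xpredT (fun x => w 0 x)).
have perm_next : perm_eq [seq next c x | x <- c] c.
  apply: uniq_perm => // [|x];
    first by rewrite (map_inj_uniq (can_inj (prev_next uc))).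
  apply/mapP/idP => [[y yc ->]|xc]; first by rewrite mem_next.
  by exists (prev c x); rewrite ?mem_prev ?next_prev.
rewrite (perm_big _ perm_next) /= -expr2.
have -> : \prod_(x <- c) A x (next c x) = (cycle_sign G c)%:~R.
  rewrite rmorph_prod big_seq [RHS]big_seq; apply: eq_bigr => x xc.
  by rewrite mxE -pc // Gv.
by rewrite neg rmorphN mulN1r oppr_gt0 ltNge sqr_ge0.
Qed.

Lemma long_cycle_bound (c : seq 'I_n) :
  uniq c -> {in c, p =1 next c} -> cycle_sign G c = -1 -> (6 <= size c)%N ->
  forall l, eigenvalue A l -> 0 < l -> l ^+ 2 < n%:R - 2.
Proof.
move=> uc pc neg size_c l /eigenvalueP[w wA w0] l0.
have [e ec le0] := nonpositive_cycle_edge w uc pc neg.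
have pec : p e \in c by rewrite pc // mem_next.
(* The cycle is rotated so that the edge with nonpositive contribution joins its last vertex [e] to
   its first. *)
have [i s ds] := rot_to pec.
have us : uniq (p e :: s) by rewrite -ds rot_uniq.
have {}pc x : x \in p e :: s -> p x = next (p e :: s) x.
  by rewrite -ds mem_rot next_rot //; apply: pc.
move: size_c; rewrite -(size_rot i) ds => size_c.
have ee : e = last (p e) s.
  have e1 : next (p e :: s) e = next (p e :: s) (last (p e) s).
    by rewrite (next_last us) -pc // -ds mem_rot.
  by rewrite -[LHS](prev_next us) e1 prev_next.
have [X X0 bipX] := bipartition_at (p e) bipG.
have bipA u v : A u v != 0 -> (u \in X) != (v \in X) by rewrite A0; exact: bipX.
set v0 := p e in us pc X0 ee le0.
case: s {ds} us pc ee size_c => [|v1 [|v2 [|v3 [|v4 [|v5 r]]]]] // us pc /= ee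
  _.
set c' := [:: v0, v1, v2, v3, v4, v5 & r] in us pc.
have pS j : (j.+1 < size c')%N -> p (nth v0 c' j) = nth v0 c' j.+1.
  by move=> lt_j; rewrite pc ?next_nthS //; apply/mem_nth/ltnW.
have p0 : p v0 = v1 := pS 0 isT.
have p1 : p v1 = v2 := pS 1 isT.
have p2 : p v2 = v3 := pS 2 isT.
have p3 : p v3 = v4 := pS 3 isT.
have p4 : p v4 = v5 := pS 4 isT.
have neq j k : (j < 6)%N -> (k < 6)%N -> j != k -> (nth v0 c' j == nth v0 c' k)
  = false.
  by move=> ltj ltk jk; rewrite nth_uniq ?(negPf jk) //=; lia.
(* The default covers the 6-cycle, where v5 is followed by v0. *)
have p5 : p v5 = head v0 r.
  case: (r) @c' us pc pS {neq} ee => [|z r'] c' us pc pS ee;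
    last exact: (pS 5 isT).
  rewrite pc; first exact: (next_last us).
  exact: (mem_last v0 [:: v1; v2; v3; v4; v5]).
have p52 : (p v5 == v2) = false.
  rewrite p5; case: (r) @c' us neq {pc pS ee} => [|z r'] c' us neq /=;
    first exact: (neq 0 2).
  exact: (nth_uniq v0 (isT : 6 < size c')%N (isT : 2 < size c')%N us).
have p50 : e = v5 \/ (p v5 == v0) = false.
  rewrite p5; case: (r) @c' us {neq pc pS} ee => [|z r'] c' us ee /=;
    first by left.
  right; exact: (nth_uniq v0 (isT : 6 < size c')%N (isT : 0 < size c')%N us).
have nA u v : (p u == v) = false -> (p v == u) = false -> A u v = 0.
  by move=> h1 h2; apply/eqP; rewrite -[_ == _]negbK A0 Gp h1 h2.
apply: (@long_negative_cycle_eigenvalue _ n A X (tr_adjacency R G) bipA A1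
  (card_biadj bipX) v0 v1 v2 v3 v4 v5 e w l);
    rewrite ?A0 ?Gp ?p0 ?p1 ?p2 ?p3 ?p4 ?eqxx ?orbT //.
- by move: us; rewrite /c' -[[:: v0, v1, v2, v3, v4, v5 & r]]/([:: v0; v1; v2;
  v3; v4; v5] ++ r) cat_uniq => /and3P[].
- rewrite ee; apply/eqP => e1; have := mem_last v5 r; rewrite e1 inE.
  move: us; rewrite /c' /= => /and3P[_ + _]; rewrite !inE !negb_or.
  by move=> /and5P[_ _ _ /negPf -> /negPf ->].
- by apply: nA; rewrite ?p0 ?p3; [apply: (neq 1 3)|apply: (neq 4 0)].
- by apply: nA; rewrite ?p4 ?p1; [apply: (neq 5 1)|apply: (neq 2 4)].
- by apply: nA; rewrite // p2; apply: (neq 3 5).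
- have [->|p5v] := p50; first by right.
  by left; apply: nA; rewrite // p0; apply: (neq 1 5).
- by rewrite symA [w 0 v0 * _]mulrC.
Qed.

(** The first alternative holds if a single vertex of the cycle is the parent of all vertices off
    it, as is vacuously so for n = 4. Otherwise equality in the bound is contradicted by showing
    that there is such a vertex. *)
Lemma square_bound_or_switching (c : seq 'I_n) :
  uniq c -> {in c, p =1 next c} -> cycle_sign G c = -1 -> size c = 4 ->
  switching_equivalent G (gamma4neg n) \/
  (4 < n)%N /\ forall l, eigenvalue A l -> 0 < l -> l ^+ 2 < n%:R - 2.
Proof.
move=> uc pc neg size_c.
have closed_c v : v \in c -> p v \in c by move=> vc; rewrite pc // mem_next.
have [/existsP[x /andP[xc /forallP px]]|] := boolP
    [exists x, (x \in c) && [forall v, (v \notin c) ==> (p v == x)]].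
  left; have [i s ds] := rot_to xc.
  have us : uniq (x :: s) by rewrite -ds rot_uniq.
  have mem_s v : (v \in x :: s) = (v \in c) by rewrite -ds mem_rot.
  have ps v : v \in x :: s -> p v = next (x :: s) v.
    by rewrite mem_s => vc; rewrite pc // -ds next_rot.
  have size_s : size (x :: s) = 4 by rewrite -ds size_rot.
  have negs : cycle_sign G (x :: s) = -1 by rewrite -ds cycle_sign_rot.
  have out v : v \notin x :: s -> p v = x.
    by rewrite mem_s => vc; have /implyP/(_ vc)/eqP := px v.
  case: s {ds mem_s} us ps size_s negs out => [|x1 [|x2 [|x3 [|]]]] // us ps _
    negs out.
  have pS j : (j < 3)%N -> p (nth x [:: x; x1; x2; x3] j) = nth x [:: x; x1;
    x2; x3] j.+1.
    by move=> lt_j; rewrite ps ?next_nthS ?mem_nth //= ltnW.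
  have p3 : p x3 = x by rewrite ps ?(next_last us) // !inE eqxx !orbT.
  apply: (switching_gamma4neg Gp us (pS 0 isT) (pS 1 isT) (pS 2 isT) p3 out).
  move: negs; rewrite /cycle_sign !big_cons big_nil mulr1.
  rewrite -!ps ?inE ?eqxx ?orbT // p3.
  by rewrite (pS 0 isT) (pS 1 isT) (pS 2 isT) /= !mulrA.
rewrite negb_exists => /forallP none; right.
have exists_out x : x \in c -> exists2 v, v \notin c & p v != x.
  by move=> xc; have := none x; rewrite xc /= negb_forall => /existsP[v];
    rewrite negb_imply => /andP[]; exists v.
have [x0 x0c] : exists x, x \in c by case: (c) size_c => // x s _; exists x;
  rewrite mem_head.
split.
  have [v vc _] := exists_out x0 x0c.
  have : uniq (v :: c) by rewrite /= vc.
  by move/card_uniqP => /= e; have := max_card (mem (v :: c));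
    rewrite e size_c card_ord.
case: c uc pc neg size_c closed_c none exists_out {x0 x0c} => [|x0 [|x1 [|x2
  [|x3 [|]]]]] //.
set c := [:: x0; x1; x2;
  x3] => uc pc neg _ closed_c _ exists_out l /eigenvalueP[w wA w0] l0.
have pS j : (j < 3)%N -> p (nth x0 c j) = nth x0 c j.+1.
  by move=> lt_j; rewrite pc ?next_nthS ?mem_nth //= ltnW.
have p3 : p x3 = x0 by rewrite pc ?(next_last uc) // !inE eqxx !orbT.
have p0 : p x0 = x1 := pS 0 isT.
have p1 : p x1 = x2 := pS 1 isT.
have p2 : p x2 = x3 := pS 2 isT.
have [X X0 bipX] := bipartition_at x0 bipG.
have bipA u v : A u v != 0 -> (u \in X) != (v \in X) by rewrite A0; exact: bipX.
have negA : A x0 x1 * A x2 x1 * A x2 x3 * A x0 x3 = -1.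
  rewrite (symA x2 x1) (symA x0 x3) !mxE !Gp p0 p1 p2 p3 !eqxx /= -!rmorphM /=.
  move: neg; rewrite /cycle_sign !big_cons big_nil mulr1.
  rewrite -!pc ?inE ?eqxx ?orbT // p0 p1 p2 p3 !mulrA => ->.
  by rewrite rmorphN.
have edge u v : p u = v \/ p v = u -> A u v != 0.
  by rewrite A0 Gp => -[] ->; rewrite eqxx ?orbT.
have [le_l eq_l] := negative_square_eigenvalue (tr_adjacency R G) bipA A1
  (card_biadj bipX) uc X0 (edge _ _ (or_introl p0)) (edge _ _ (or_intror p1))
  (edge _ _ (or_introl p2)) (edge _ _ (or_intror p3)) negA wA w0 (lt0r_neq0 l0).
rewrite lt_neqAle le_l andbT; apply/eqP => e.
have [[g g0 wg] [i0 [j0 [i0c j0c wij]]]] := eq_l e.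
have X1 : x1 \notin X by have := bipX _ _ (Gv x0); rewrite p0 X0;
  case: (x1 \in X).
have X2 : x2 \in X by have := bipX _ _ (Gv x1); rewrite p1 (negPf X1);
  case: (x2 \in X).
have X3 : x3 \notin X by have := bipX _ _ (Gv x2); rewrite p2 X2;
  case: (x3 \in X).
have i0X : i0 \in X by move: i0c; rewrite !inE => /orP[] /eqP ->.
have j0X : j0 \notin X by move: j0c; rewrite !inE => /orP[] /eqP ->.
have {}i0c : i0 \in c by move: i0c; rewrite !inE => /orP[] ->; rewrite ?orbT.
have {}j0c : j0 \in c by move: j0c; rewrite !inE => /orP[] ->; rewrite ?orbT.
have [wi wj] : w 0 i0 != 0 /\ w 0 j0 != 0.
  by move: wij; rewrite mulf_eq0 negb_or => /andP.
have out_g u v : u \notin c -> (u \in X) != (v \in X) -> w 0 u * w 0 v = A u v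
  * g.
  move=> uout; have [uX|uX] := boolP (u \in X) => vX.
    apply: wg => //.
    apply: contra uout => /andP[+ _].
    by rewrite !inE => /orP[] ->; rewrite ?orbT.
  rewrite mulrC symA; apply: wg => //; first by move: vX; case: (v \in X).
  apply: contra uout => /andP[_].
  by rewrite !inE => /orP[] ->; rewrite ?orbT.
(* The edge from v to its parent has product +-g, which is nonzero. *)
have w_out v : v \notin c -> w 0 v != 0.
  move=> vout; have := out_g v (p v) vout (bipX _ _ (Gv v)).
  apply: contra_eq_neq => ->; rewrite mul0r eq_sym mulf_neq0 //.
  by apply: edge; left.
(* Conversely, a nonzero product off the block can only come from an edge. *)
have adj_out u v : u \notin c -> (u \in X) != (v \in X) -> w 0 v != 0 ->
    ugraph G u v.
  move=> uout uv wv; rewrite -A0;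
    apply: contra_neq (mulf_neq0 (w_out u uout) wv).
  by rewrite out_g // => ->; rewrite mul0r.
(* As [p] preserves the cycle, an edge leaving it goes from the outer vertex to its parent. *)
have parent_out u v : u \notin c -> v \in c -> (u \in X) != (v \in X) ->
    w 0 v != 0 -> p u = v.
  move=> uout vc uv wv; have := adj_out _ _ uout uv wv; rewrite Gp.
  by case/orP => /eqP // e'; move: uout; rewrite -e' closed_c.
(* Two outer vertices on opposite sides would be adjacent, hence one the parent of the other; but
   both have parents on the cycle, by [i0] and [j0]. *)
have same_side u v : u \notin c -> v \notin c -> (u \in X) = (v \in X).
  move=> uout vout; apply/eqP/negPn/negP => uv.
  have pu : p u \in c.
    by case uX: (u \in X);
      [rewrite (parent_out u j0)|rewrite (parent_out u i0)] => //;
       rewrite uX ?i0X ?(negPf j0X).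
  have pv : p v \in c.
    by case vX: (v \in X);
      [rewrite (parent_out v j0)|rewrite (parent_out v i0)] => //;
       rewrite vX ?i0X ?(negPf j0X).
  have := adj_out _ _ uout uv (w_out _ vout); rewrite Gp => /orP[] /eqP e'.
    by move: vout; rewrite -e' pu.
  by move: uout; rewrite -e' pv.
have [v vout _] := exists_out i0 i0c.
(* All outer vertices lie on one side, so the vertex among [i0] and [j0] on the other side is the
   parent of all of them. *)
pose x := if v \in X then j0 else i0.
have xc : x \in c by rewrite /x; case: ifP.
have [u uout] := exists_out x xc; rewrite (parent_out u x) ?eqxx //.
  by rewrite (same_side u v) // /x; case: ifP => _; rewrite ?i0X ?(negPf j0X).
by rewrite /x; case: ifP.
Qed.

End Unicyclic.

Theorem theorem3p6 (R : realType) (n : nat) (hn : (4 <= n)%N)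
    (G : signed_graph n) (hG : unbalanced_bipartite_unicyclic G) :
  EE R G <= EE R (gamma4neg n) /\
  (EE R G = EE R (gamma4neg n) <-> switching_equivalent G (gamma4neg n)).
Proof.
have [/unbalanced_cycle[c cycG neg] bipG uniG] := hG.
have [p [pc pp Gp]] := unicyclic_parent uniG cycG.
have [size3 /andP[cyc uc]] := cycG.
(* The sides alternate along the cycle, which excludes the lengths 3 and 5. *)
have sizec : size c = 4 \/ (6 <= size c)%N.
  have [X bipX] := bipG.
  have step x : (x \in X) != (p x \in X) by apply: bipX; rewrite Gp eqxx.
  case: c size3 cyc {uc pc neg cycG} => [|a [|b [|c' [|d [|e [|f r]]]]]] //= _;
    auto.
    move=> /and4P[/bipX + /bipX + /bipX + _].
    by case: (a \in X); case: (b \in X); case: (c' \in X).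
  move=> /and5P[/bipX + /bipX + /bipX + /bipX + /andP[/bipX + _]].
  by case: (a \in X); case: (b \in X); case: (c' \in X); case: (d \in X);
    case: (e \in X).
have [sw|[n4 bound]] : switching_equivalent G (gamma4neg n) \/
    (4 < n)%N /\ forall l, eigenvalue (adjacency R G) l -> 0 < l -> l ^+ 2 <
      n%:R - 2.
- case: sizec => sizec;
  first exact: (square_bound_or_switching R pp Gp bipG uc pc neg sizec).
  right; split; last exact: (long_cycle_bound pp Gp bipG uc pc neg sizec).
  rewrite -[X in (_ < X)%N](card_ord n); apply: leq_trans (max_card (mem c)).
  by rewrite (card_uniqP uc) ltnW.
- by rewrite (EE_switching R sw).
have [X bipX] := bipG.
have lt_EE := EE_lt_gamma4neg n4 pp Gp bipX bound.
split; first exact: ltW.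
by split=> [e|/(EE_switching R) e]; move: lt_EE; rewrite e ltxx.
Qed.
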